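(* Let $G$ be a compactly generated locally compact Hausdorff topological group, and let $\alpha$ be the canonical action of $G$ on $B^{\infty}(G)$, the closed unit ball of $L^1(G)'$ with the weak-$^{\ast}$ topology, given by $\alpha(g,l)(f) = l(f \circ \lambda_G(g))$. Then $G$ is compact if and only if $\alpha$ has vanishing topological entropy.
   Context: $\mathbb{N}$ is the set of natural numbers excluding $0$. A subset $S \subseteq G$ generates $G$ if $S$ contains the neutral element $e_G$ and $G = \bigcup_{n\in\mathbb{N}} S^n$, where $S^n = \{s_1\cdots s_n \mid s_i \in S\}$; $G$ is compactly generated if it has a compact generating subset. Fix $\mathbb{K} \in \{\mathbb{R},\mathbb{C}\}$ and a left Haar measure $\mu$ on $G$; $L^1(G)$ is the Banach space of ($\mathbb{K}$-valued) $\mu$-integrable functions (modulo null functions) with norm $\|\cdot\|_1$, and $L^1(G)'$ is its dual Banach space. $B^{\infty}(G)$ is the closed unit ball of $L^1(G)'$ endowed with the weak-$^{\ast}$ topology, i.e., the initial topology with respect to the maps $B^\infty(G)\to\mathbb{K}$, $l \mapsto l(f)$, $f \in L^1(G)$; it is a compact Hausdorff space. For $g \in G$, $\lambda_G(g)\colon G \to G$, $x \mapsto gx$. The map $\alpha \colon G \times B^{\infty}(G) \to B^{\infty}(G)$, $\alpha(g,l)(f) = l(f\circ\lambda_G(g))$ ($f \in L^1(G)$), is a continuous action of $G$ on $B^{\infty}(G)$. Entropy. Let $\alpha$ be a continuous action of a topological group $G$ on a compact Hausdorff space $X$. $\mathcal{C}(X)$ is the set of finite open coverings of $X$. For $\mathcal{U},\mathcal{V}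 \in \mathcal{C}(X)$ and $S \subseteq G$, write $\mathcal{U} \preceq_S^{\alpha} \mathcal{V}$ if for every $g \in S$ and every $V \in \mathcal{V}$ there is $U \in \mathcal{U}$ with $\alpha(g,V) = \{\alpha(g,x) \mid x\in V\} \subseteq U$. For compact $S \subseteq G$, $(S:\mathcal{U})_{\alpha} = \inf\{|\mathcal{V}| \mid \mathcal{V} \in \mathcal{C}(X),\ \mathcal{U} \preceq_S^{\alpha}\mathcal{V}\}$ (this is finite). For a compact generating subset $S$ of $G$, $\eta(\alpha,S,\mathcal{U}) = \limsup_{n\to\infty} \frac{\log_2 (S^n:\mathcal{U})_{\alpha}}{n}$ and $\eta(\alpha,S) = \sup\{\eta(\alpha,S,\mathcal{U}) \mid \mathcal{U}\in\mathcal{C}(X)\}$. For $G$ compactly generated and locally compact Hausdorff, $\alpha$ has vanishing topological entropy if $\eta(\alpha,S) = 0$ for some (equivalently, any) compact generating subset $S \subseteq G$. *)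

(* Defs.v *)
From HB Require Import structures.
From mathcomp Require Import all_boot all_order all_algebra.
From mathcomp Require Import generic_quotient ring_quotient complex.
From mathcomp Require Import finmap all_classical all_reals all_analysis.
From mathcomp Require Import measurable_realfun.

Set Implicit Arguments.
Unset Strict Implicit.
Unset Printing Implicit Defensive.

Import Order.TTheory GRing.Theory Num.Theory.
Import numFieldNormedType.Exports.

Local Open Scope classical_set_scope.
Local Open Scope ring_scope.

(* Pointedness is only there because MathComp-Analysis requires it of every
   measurable space; the distinguished point plays no role. *)
HB.mixin Record isTopologicalGroup G & PointedTopological G & Group G := {
  mulg_continuous : continuous (fun x : G * G => (x.1 * x.2)%g);
  invg_continuous : continuous (fun x : G => (x^-1)%g)
}.

#[short(type="topologicalGroupType")]
HB.structure Definition TopologicalGroup :=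
  {G of PointedTopological G & Group G & isTopologicalGroup G}.

Section generating_sets.
Variable G : topologicalGroupType.
Implicit Types S : set G.

Definition set_pow S n : set G :=
  [set (\prod_(i < n) s i)%g | s in [set s : 'I_n -> G | forall i, S (s i)]].

Definition generating S :=
  S 1%g /\ \bigcup_(n in [set n | (0 < n)%N]) set_pow S n = [set: G].

Definition compactly_generated := exists S, compact S /\ generating S.

End generating_sets.

Section entropy.
Variables (R : realType) (G : topologicalGroupType) (X : topologicalType).
Implicit Types (alpha : G -> X -> X) (S : set G) (U V : set (set X)).

Definition finite_open_cover : set (set (set X)) :=
  [set U | [/\ finite_set U, U `<=` open & \bigcup_(A in U) A = [set: X]]].

(* U \preceq_S^\alpha V *)
Definition refines alpha S U V :=
  forall g B, S g -> V B -> exists2 A, U A & alpha g @` B `<=` A.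

Local Open Scope ereal_scope.

(* (S : U)_\alpha *)
Definition cover_number alpha S U : \bar R :=
  ereal_inf [set ((#|` fset_set V|)%:R)%:E
            | V in [set V | finite_open_cover V /\ refines alpha S U V]].

Definition log2e (x : \bar R) : \bar R := lne x * ((ln 2)^-1)%:E.

(* The 0-th term of the sequence is irrelevant to the limsup. *)
Definition cover_entropy alpha S U : \bar R :=
  limn_esup (fun n => log2e (cover_number alpha (set_pow S n) U)
                      * (n%:R^-1)%:E).

Definition entropy alpha S : \bar R :=
  ereal_sup [set cover_entropy alpha S U | U in finite_open_cover].

Definition vanishing_entropy alpha :=
  exists S, [/\ compact S, generating S & entropy alpha S = 0].

End entropy.

Section scalars.
Variable R : realType.

Variant scalar_kind := RealScalars | ComplexScalars.

Definition scalars (k : scalar_kind) : numFieldType :=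
  match k with RealScalars => R | ComplexScalars => R[i]%C end.

Definition sre k : scalars k -> R :=
  match k with RealScalars => id | ComplexScalars => @complex.Re R end.

Definition sim k : scalars k -> R :=
  match k with RealScalars => fun=> 0 | ComplexScalars => @complex.Im R end.

Definition of_real k : R -> scalars k :=
  match k with
  | RealScalars => id | ComplexScalars => fun x : R => x%:C%C end.

(* The absolute value as a real number: the norm `|z| of a numFieldType takes
   its values in the field itself, even for R[i]. *)
Definition sabs k (z : scalars k) : R := sre `|z|.

Lemma sreD k (x y : scalars k) : sre (x + y) = sre x + sre y.
Proof. by case: k x y => //= -[a b] [c d]. Qed.

Lemma simD k (x y : scalars k) : sim (x + y) = sim x + sim y.
Proof. by case: k x y => [x y|[a b] [c d]] //=; rewrite addr0. Qed.

Lemma sreM k (x y : scalars k) : sre (x * y) = sre x * sre y - sim x * sim y.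
Proof. by case: k x y => [x y|[a b] [c d]] //=; rewrite mulr0 subr0. Qed.

Lemma simM k (x y : scalars k) : sim (x * y) = sre x * sim y + sim x * sre y.
Proof. by case: k x y => [x y|[a b] [c d]] //=; rewrite mulr0 mul0r addr0. Qed.

Lemma sre0 k : sre (0 : scalars k) = 0. Proof. by case: k. Qed.

Lemma sim0 k : sim (0 : scalars k) = 0. Proof. by case: k. Qed.

Lemma of_realD k x y : of_real k (x + y) = of_real k x + of_real k y.
Proof. by case: k => //=; rewrite rmorphD. Qed.

Lemma of_realM k x y : of_real k (x * y) = of_real k x * of_real k y.
Proof. by case: k => //=; rewrite rmorphM. Qed.

Lemma of_real0 k : of_real k 0 = 0.
Proof. by case: k. Qed.

Lemma ler_of_real k x y : (of_real k x <= of_real k y) = (x <= y).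
Proof. by case: k => //=; rewrite lecR. Qed.

Lemma of_real_inj k : injective (of_real k).
Proof. by case: k => // x y []. Qed.

Lemma sabsE k (z : scalars k) : `|z| = of_real k (sabs z).
Proof.
by case: k z => // z; rewrite /sabs /sre /of_real normc_def.
Qed.

Lemma sabs_ge0 k (z : scalars k) : 0 <= sabs z.
Proof. by rewrite -(ler_of_real k) of_real0 -sabsE. Qed.

Lemma ler_sabsD k (x y : scalars k) : sabs (x + y) <= sabs x + sabs y.
Proof. by rewrite -(ler_of_real k) of_realD -!sabsE ler_normD. Qed.

Lemma sabsM k (x y : scalars k) : sabs (x * y) = sabs x * sabs y.
Proof. by apply: (@of_real_inj k); rewrite of_realM -!sabsE normrM. Qed.

Lemma sabs_eq0 k (z : scalars k) : sabs z = 0 -> z = 0.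
Proof. by move=> z0; apply/normr0_eq0; rewrite sabsE z0 of_real0. Qed.

Lemma sabs_sqrt k (z : scalars k) : sabs z = Num.sqrt (sre z ^+ 2 + sim z ^+ 2).
Proof.
case: k z => [z|z]; last by rewrite /sabs /sre /sim normc_def.
by rewrite /sabs /= expr0n /= addr0 sqrtr_sqr.
Qed.

Lemma sabs_le k (z : scalars k) : sabs z <= `|sre z| + `|sim z|.
Proof.
rewrite sabs_sqrt -[leRHS]ger0_norm ?addr_ge0// -sqrtr_sqr ler_wsqrtr//.
rewrite sqrrD !real_normK ?num_real// lerD2r lerDl.
by rewrite mulrn_wge0// mulr_ge0.
Qed.

End scalars.

Section L1_space.
Context d (T : measurableType d) (R : realType) (k : scalar_kind).
Variable mu : {measure set T -> \bar R}.
Local Notation K := (scalars R k).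
Implicit Types f g : T -> K.

Definition K_integrable f :=
  mu.-integrable setT (EFin \o (@sre R k \o f)) /\
  mu.-integrable setT (EFin \o (@sim R k \o f)).

Definition L1fun_pred : {pred T -> K} := mem [set f | K_integrable f].

Lemma K_integrableZ a f : K_integrable f -> K_integrable (a *: f).
Proof.
move=> [fr fi]; split.
- rewrite (_ : _ \o _ =
    (fun x => (sre a)%:E * (sre (f x))%:E - (sim a)%:E * (sim (f x))%:E)%E).
    by apply: integrableB => //; exact: integrableZl.
  by apply/funext => x /=; rewrite sreM.
- rewrite (_ : _ \o _ =
    (fun x => (sre a)%:E * (sim (f x))%:E + (sim a)%:E * (sre (f x))%:E)%E).
    by apply: integrableD => //; exact: integrableZl.
  by apply/funext => x /=; rewrite simM.
Qed.

Lemma K_integrableD f g : K_integrable f -> K_integrable g ->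
  K_integrable (f + g).
Proof.
move=> [fr fi] [gr gi]; split.
- rewrite (_ : _ \o _ = (fun x => (sre (f x))%:E + (sre (g x))%:E)%E).
    exact: integrableD.
  by apply/funext => x /=; rewrite sreD.
- rewrite (_ : _ \o _ = (fun x => (sim (f x))%:E + (sim (g x))%:E)%E).
    exact: integrableD.
  by apply/funext => x /=; rewrite simD.
Qed.

Lemma K_integrable0 : K_integrable 0.
Proof.
split.
- rewrite (_ : _ \o _ = cst 0%E); first exact: integrable0.
  by apply/funext => x /=; rewrite sre0.
- rewrite (_ : _ \o _ = cst 0%E); first exact: integrable0.
  by apply/funext => x /=; rewrite sim0.
Qed.

Lemma L1fun_submod_closed : submod_closed L1fun_pred.
Proof.
split=> [|a f g]; rewrite !inE /=; first exact: K_integrable0.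
by move=> fi gi; apply: K_integrableD => //; exact: K_integrableZ.
Qed.

HB.instance Definition _ :=
  GRing.isSubmodClosed.Build K (T -> K) L1fun_pred L1fun_submod_closed.

Record L1fun := mkL1fun { L1fun_val :> T -> K; _ : L1fun_val \in L1fun_pred }.

HB.instance Definition _ := [isSub for L1fun_val].
HB.instance Definition _ := [Choice of L1fun by <:].
HB.instance Definition _ := [SubChoice_isSubLmodule of L1fun by <:].

Lemma L1funD (f g : L1fun) : L1fun_val (f + g) = f + g :> (T -> K).
Proof. exact: (raddfD val). Qed.

Lemma L1funB (f g : L1fun) : L1fun_val (f - g) = f - g :> (T -> K).
Proof. exact: (raddfB val). Qed.

Lemma L1funZ a (f : L1fun) : L1fun_val (a *: f) = a *: (f : T -> K) :> (T -> K).
Proof. by []. Qed.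

Lemma L1funP (f : L1fun) : K_integrable f.
Proof. by have := valP f; rewrite inE. Qed.

Definition null_funs : {pred L1fun} := mem [set f : L1fun | f = cst 0 %[ae mu]].

Lemma null_funs_zmod_closed : zmod_closed null_funs.
Proof.
split=> [|f g]; rewrite !inE /=; first exact/aeW.
move=> f0 g0; apply: filterS2 f0 g0 => x fx gx xT.
by rewrite -[LHS]/(f x - g x) fx// gx// subrr.
Qed.

HB.instance Definition _ :=
  GRing.isZmodClosed.Build L1fun null_funs null_funs_zmod_closed.

Lemma null_funsZ a (f : L1fun) : f \in null_funs -> a *: f \in null_funs.
Proof.
rewrite !inE /=; apply: filterS => x fx xT.
by rewrite -[LHS]/(a *: f x) fx// scaler0.
Qed.

(* L1fun consists of functions, L1 of their classes modulo null functions. *)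
Definition L1 : Type := Quotient.quot null_funs.

HB.instance Definition _ := GRing.Zmodule.on L1.
HB.instance Definition _ := EqQuotient.on L1.


Definition L1class (f : L1fun) : L1 := (\pi_L1 f)%qT.

Lemma L1classP (f g : L1fun) : L1class f = L1class g <-> f = g %[ae mu].
Proof.
split=> [/eqP|fg].
  rewrite -Quotient.idealrBE inE /=; apply: filterS => x fgx xT.
  by apply/subr0_eq; exact: fgx.
apply/eqP; rewrite -Quotient.idealrBE inE /=; apply: filterS fg => x fgx xT.
by rewrite -[LHS]/(f x - g x) fgx// subrr.
Qed.

Lemma L1classD (f g : L1fun) : L1class (f + g) = L1class f + L1class g.
Proof. exact: Quotient.pi_add. Qed.

Lemma L1class0 : L1class 0 = 0.
Proof. by apply: (addIr (L1class 0)); rewrite -L1classD !add0r. Qed.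

Definition L1scale a (u : L1) : L1 := L1class (a *: repr u).

Lemma L1scaleE a (f : L1fun) : L1scale a (L1class f) = L1class (a *: f).
Proof.
apply/eqP; rewrite -Quotient.idealrBE -scalerBr null_funsZ//.
by rewrite Quotient.idealrBE reprK.
Qed.

Lemma L1classK u : L1class (repr u) = u. Proof. exact: reprK. Qed.

Lemma L1scaleA a b u : L1scale a (L1scale b u) = L1scale (a * b) u.
Proof. by rewrite -[u]L1classK !L1scaleE scalerA. Qed.

Lemma L1scale1 : left_id 1 L1scale.
Proof. by move=> u; rewrite -[u]L1classK L1scaleE scale1r. Qed.

Lemma L1scaleDr : right_distributive L1scale +%R.
Proof.
move=> a u v; rewrite -[u]L1classK -[v]L1classK.
by rewrite -L1classD !L1scaleE scalerDr L1classD.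
Qed.

Lemma L1scaleDl u : {morph L1scale^~ u : a b / a + b}.
Proof.
by move=> a b; rewrite -[u]L1classK !L1scaleE scalerDl L1classD.
Qed.

HB.instance Definition _ :=
  GRing.Zmodule_isLmodule.Build K L1 L1scaleA L1scale1 L1scaleDr L1scaleDl.

Lemma L1classZ a (f : L1fun) : L1class (a *: f) = a *: L1class f.
Proof. by rewrite -L1scaleE. Qed.

Lemma measurable_sabs (f : L1fun) : measurable_fun setT (@sabs R k \o f).
Proof.
have [fr fi] := L1funP f.
rewrite (_ : _ \o _ = (fun x => Num.sqrt (sre (f x) ^+ 2 + sim (f x) ^+ 2)));
  last by apply/funext => x /=; rewrite sabs_sqrt.
have msqrt : measurable_fun [set: R] (@Num.sqrt R).
  by apply: continuous_measurable_fun; exact: sqrt_continuous.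
apply: (measurableT_comp msqrt); apply: measurable_funD.
  by apply: measurable_funX; apply/measurable_EFinP; exact: measurable_int fr.
by apply: measurable_funX; apply/measurable_EFinP; exact: measurable_int fi.
Qed.

Lemma integrable_sabs (f : L1fun) :
  mu.-integrable setT (EFin \o (@sabs R k \o f)).
Proof.
have [fr fi] := L1funP f.
apply: (@le_integrable _ _ _ mu _ measurableT _
  (fun x => `|(sre (f x))%:E| + `|(sim (f x))%:E|)%E).
- by apply/measurable_EFinP; exact: measurable_sabs.
- move=> x _ /=; rewrite lee_fin [leLHS]ger0_norm ?sabs_ge0//.
  by rewrite [leRHS]ger0_norm ?addr_ge0// sabs_le.
- by apply: integrableD => //; exact: integrable_abse.
Qed.

Definition L1norm1 (u : L1) : R := \int[mu]_x sabs (repr u x).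

Lemma L1norm1E (f : L1fun) : L1norm1 (L1class f) = \int[mu]_x sabs (f x).
Proof.
rewrite /L1norm1 /Rintegral; congr fine; apply: ae_eq_integral => //.
- by apply/measurable_EFinP; exact: measurable_sabs.
- by apply/measurable_EFinP; exact: measurable_sabs.
have /L1classP : L1class (repr (L1class f)) = L1class f by exact: L1classK.
by apply: filterS => x fx xT; rewrite fx.
Qed.

Lemma L1norm1_ge0 u : 0 <= L1norm1 u.
Proof. by apply: Rintegral_ge0 => x _; exact: sabs_ge0. Qed.

Lemma ler_L1norm1D u v : L1norm1 (u + v) <= L1norm1 u + L1norm1 v.
Proof.
rewrite -[u]L1classK -[v]L1classK -L1classD !L1norm1E.
rewrite -RintegralD//; [|exact: integrable_sabs..].
apply: le_Rintegral => //; first exact: integrable_sabs.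
  exact: (integrableD measurableT (integrable_sabs _) (integrable_sabs _)).
by move=> x _; exact: ler_sabsD.
Qed.

Lemma L1norm1Z a u : L1norm1 (a *: u) = sabs a * L1norm1 u.
Proof.
rewrite -[u]L1classK -L1classZ !L1norm1E -RintegralZl//.
  by apply: eq_Rintegral => x _; exact: sabsM.
exact: integrable_sabs.
Qed.

Lemma L1norm1_eq0 u : L1norm1 u = 0 -> u = 0.
Proof.
rewrite -[u]L1classK L1norm1E => /eqP.
have f_int := integrable_sabs (repr u).
rewrite fine_eq0 ?integrable_fin_num// => /eqP f0; rewrite -L1class0.
apply/L1classP.
have [h _] := ae_eq_integral_abs mu measurableT (measurable_int _ f_int).
have : (\int[mu]_x `|(EFin \o (@sabs R k \o repr u)) x| = 0)%E.
  by rewrite -[RHS]f0; apply: eq_integral => x _ /=; rewrite ger0_norm ?sabs_ge0.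
move=> /h; apply: filterS => x fx xT.
by apply: sabs_eq0; apply: EFin_inj; exact: fx.
Qed.

(* Same norm, with values in K as required of a normed space over K. *)
Definition L1norm (u : L1) : K := of_real k (L1norm1 u).

Lemma ler_L1normD u v : L1norm (u + v) <= L1norm u + L1norm v.
Proof. by rewrite -of_realD ler_of_real ler_L1norm1D. Qed.

Lemma L1normZ a u : L1norm (a *: u) = `|a| * L1norm u.
Proof. by rewrite /L1norm L1norm1Z of_realM -sabsE. Qed.

Lemma L1norm_eq0 u : L1norm u = 0 -> u = 0.
Proof. by rewrite /L1norm -[0](of_real0 R k) => /of_real_inj/L1norm1_eq0. Qed.

HB.instance Definition _ :=
  Lmodule_isNormed.Build K L1 ler_L1normD L1normZ L1norm_eq0.

Lemma normL1E (u : L1) : `|u| = of_real k (L1norm1 u). Proof. by []. Qed.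

End L1_space.

Section dual.
Context (R : realType) (k : scalar_kind).
Local Notation K := (scalars R k).
Variable V : normedModType K.

Definition dual : set (V -> K) := [set l : V -> K | scalar l /\ continuous l].

Definition dual_norm (l : V -> K) : R :=
  sup [set sabs (l u) | u in [set u : V | `|u| <= 1]].

Definition dual_ball : set (V -> K) := [set l : V -> K | dual l /\ dual_norm l <= 1].

(* Initial topology with respect to all the evaluations l |-> l u: the
   supremum of the initial topologies of the single evaluations. *)
Definition weak_star_ball : topologicalType := sup_topology (fun u : V =>
  Topological.class (initial_topology (fun l : dual_ball => val l u))).

Lemma dual_bounded l : dual l ->
  has_sup [set sabs (l u) | u in [set u : V | `|u| <= 1]].
Proof.
move=> [l_lin l_cont].
pose L : {linear V -> K^o} := HB.pack l (GRing.isLinear.Build K V K^o *:%R l l_lin).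
have /linear_boundedP/pinfty_ex_gt0[M M0 lM] : bounded_near L (nbhs 0).
  by apply/linear_bounded_continuous; exact: l_cont.
split; first by exists (sabs (l 0)), 0 => //=; rewrite normr0 ler01.
exists (sabs M) => _ [u /= u1 <-].
rewrite -(ler_of_real k) -!sabsE (ger0_norm (ltW M0)).
by apply: le_trans (lM u) _; rewrite ler_piMr// ltW.
Qed.

End dual.
Arguments dual_ball {R k} V _.

Notation borel G := (g_sigma_algebraType (@open G)).

Section haar.
Variables (G : topologicalGroupType) (R : realType).

(* Haar measures are nonzero left-invariant Radon measures; regularity has to be
   required since G need not be second countable. *)
Record left_haar (mu : {measure set (borel G) -> \bar R}) : Prop := LeftHaar {
  haar_neq0 : mu [set: G] != 0%E;
  haar_compact : forall C : set G, compact C -> (mu C < +oo)%E;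
  haar_outer : forall A : set (borel G), measurable A ->
    mu A = ereal_inf [set mu U | U in [set U : set G | open U /\ A `<=` U]];
  haar_inner : forall U : set G, open U ->
    mu U = ereal_sup [set mu C | C in [set C : set G | compact C /\ C `<=` U]];
  haar_left : forall (g : G) (A : set (borel G)), measurable A ->
    mu [set (g * x)%g | x in A] = mu A
}.

End haar.

Section haar_action.
Context (G : topologicalGroupType) (R : realType) (k : scalar_kind).
Variables (mu : {measure set (borel G) -> \bar R}) (hmu : left_haar mu).
Local Notation K := (scalars R k).

Definition ltransl (g : G) : borel G -> borel G := fun x => (g * x)%g.

Lemma continuous_ltransl (g : G) : continuous (fun x : G => (g * x)%g).
Proof.
move=> x; apply: (@continuous_comp _ _ _ (fun y : G => (g, y))
  (fun y : G * G => (y.1 * y.2)%g)); last exact: mulg_continuous.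
by apply: cvg_pair; [exact: cvg_cst|exact: cvg_id].
Qed.

Lemma measurable_ltransl g : measurable_fun setT (ltransl g).
Proof.
apply: (@measurability _ _ (borel G) (borel G) setT (ltransl g) (@open G)) => //.
move=> _ [U oU <-].
rewrite setTI; apply: sub_sigma_algebra.
by apply: open_comp => // x _; exact: continuous_ltransl.
Qed.

Lemma haar_preimage g A : measurable A -> mu (ltransl g @^-1` A) = mu A.
Proof.
move=> mA; rewrite -[RHS](haar_left hmu g^-1%g)//; congr (mu _).
apply/seteqP; split => [x gxA|_ [x Ax <-]].
  by exists (g * x)%g => //; rewrite mulKg.
by rewrite /preimage /ltransl /= mulVKg.
Qed.

Lemma integral_ltransl g (f : borel G -> \bar R) :
  measurable_fun setT f -> (forall x, 0 <= f x)%E ->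
  (\int[mu]_x f (ltransl g x) = \int[mu]_x f x)%E.
Proof.
move=> mf f0.
have <- := ge0_integral_pushforward (measurable_ltransl g) mu measurableT mf
  (fun x _ => f0 x).
apply: eq_measure_integral => [|mg A mA _]; first exact: measurable_ltransl.
exact: haar_preimage.
Qed.

Lemma integrable_ltransl g (f : borel G -> \bar R) :
  mu.-integrable setT f -> mu.-integrable setT (f \o ltransl g).
Proof.
move=> /integrableP[mf foo]; apply/integrableP; split.
  exact: (measurableT_comp mf (measurable_ltransl g)).
have maf : measurable_fun setT (abse \o f) by exact: measurableT_comp.
by rewrite (integral_ltransl g maf (fun x => abse_ge0 (f x))).
Qed.

Lemma K_integrable_ltransl g (f : L1fun k mu) :
  (f \o ltransl g : borel G -> K) \in L1fun_pred mu.
Proof.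
have [fr fi] := L1funP f.
rewrite inE; split; first exact: (integrable_ltransl g fr).
exact: (integrable_ltransl g fi).
Qed.

Definition L1fun_ltransl g (f : L1fun k mu) : L1fun k mu :=
  mkL1fun (K_integrable_ltransl g f).

Definition L1_ltransl g (u : L1 k mu) : L1 k mu :=
  L1class (L1fun_ltransl g (repr u)).

Lemma L1_ltranslE g (f : L1fun k mu) :
  L1_ltransl g (L1class f) = L1class (L1fun_ltransl g f).
Proof.
apply/L1classP.
have /L1classP [N [mN N0 fN]] : L1class (repr (L1class f)) = L1class f.
  exact: L1classK.
exists (ltransl g @^-1` N); split.
- by rewrite -[X in measurable X]setTI; exact: measurable_ltransl.
- by rewrite haar_preimage.
- by move=> x /= fx; apply: fN => /= fgx; apply: fx => xT; exact: fgx.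
Qed.

Lemma L1_ltransl_linear g : linear (L1_ltransl g).
Proof.
move=> a u v; rewrite -[u]L1classK -[v]L1classK -L1classZ -L1classD.
rewrite !L1_ltranslE -L1classZ -L1classD; congr L1class.
exact: val_inj.
Qed.

Lemma norm_L1_ltransl g u : `|L1_ltransl g u| = `|u|.
Proof.
rewrite -[u]L1classK L1_ltranslE !normL1E !L1norm1E; congr (of_real k (fine _)).
apply: (integral_ltransl g (f := EFin \o (@sabs R k \o repr u))).
  by apply/measurable_EFinP; exact: measurable_sabs.
by move=> x; rewrite lee_fin sabs_ge0.
Qed.

Lemma continuous_L1_ltransl g : continuous (L1_ltransl g).
Proof.
move=> u; apply/(@cvgrPdist_lt _ _ _ (nbhs u)) => e e0; near=> v.
have -> : L1_ltransl g u - L1_ltransl g v = L1_ltransl g (u - v).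
  by rewrite -scaleN1r addrC -L1_ltransl_linear scaleN1r addrC.
by rewrite norm_L1_ltransl; near: v; exact: cvgr_dist_lt.
Unshelve. all: by end_near. Qed.

Lemma haar_action_subproof g (l : weak_star_ball (L1 k mu)) :
  (val (l : dual_ball (L1 k mu)) \o L1_ltransl g) \in dual_ball (L1 k mu).
Proof.
have /set_mem[/= l_dual l_le1] := valP l; have [l_lin l_cont] := l_dual.
rewrite inE /dual_ball /dual /=; split.
  split => [a u v|u] /=; first by rewrite L1_ltransl_linear l_lin.
  by apply: continuous_comp; [exact: continuous_L1_ltransl|exact: l_cont].
apply: le_trans l_le1; apply: ge_sup.
  by exists (sabs (val l (L1_ltransl g 0))), 0 => //=; rewrite normr0 ler01.
move=> _ [u /= u1 <-]; apply: ub_le_sup; first by case: (dual_bounded l_dual).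
by exists (L1_ltransl g u) => //=; rewrite norm_L1_ltransl.
Qed.

Definition haar_action (g : G) (l : weak_star_ball (L1 k mu)) :
  weak_star_ball (L1 k mu) :=
  exist (fun m => m \in dual_ball (L1 k mu)) _ (haar_action_subproof g l).

Lemma haar_actionE g (l : dual_ball (L1 k mu)) (f : L1fun k mu) :
  val (haar_action g l : dual_ball (L1 k mu)) (L1class f) =
  val l (L1class (L1fun_ltransl g f)).
Proof. by rewrite /= L1_ltranslE. Qed.

End haar_action.
Arguments haar_action {G R} k {mu} hmu g l.

(* Main.v *)
Require Import Defs.
From mathcomp Require Import all_boot all_order all_algebra.
From mathcomp Require Import complex finmap.
From mathcomp Require Import all_classical all_reals all_analysis.
From mathcomp Require Import lra measurable_realfun.

(** If [G] is compact, the action is jointly continuous (translation is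
    continuous in [L^1]) on a compact space (Banach-Alaoglu), so a finite open
    cover has a finite open refinement that is uniform over all of [G]; the
    cover numbers of [S^n] are then bounded.

    If [G] is not compact, [G] is the increasing union of the compact sets
    [S^n `&` (S^n)^-1], so one of them, [A], has positive measure, and
    [A A^-1 `<=` S^K] for some [K].  For each [N] there is a word of length
    [N (K + 1)] over [S] representing no shorter element.  For distinct
    suffixes [h_i], [h_j] of it, of lengths multiples of [K + 1],
    [h_i h_j^-1] is not in [S^K], so the sets [h_i^-1 A] are disjoint.
    Integration against a function with values [1] or [-1], prescribed on each
    of these sets, yields [2^N] functionals, pairwise separated at some [h_j]
    by the value at the normalized indicator of [A].  Hence the cover number of
    [S^(N (K + 1))] is at least [2^N] and the entropy at least [1 / (K + 1)]. *)

Set Implicit Arguments.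
Unset Strict Implicit.
Unset Printing Implicit Defensive.

Import Order.TTheory GRing.Theory Num.Theory.
Import numFieldNormedType.Exports HBSimple.

Local Open Scope classical_set_scope.
Local Open Scope ring_scope.

(** * Real and imaginary parts of scalars *)

Section scalar_lemmas.
Variables (R : realType) (k : scalar_kind).
Local Notation K := (scalars R k).
Implicit Types z w : K.

Lemma normr_sre_le z : `|sre z| <= sabs z.
Proof.
rewrite sabs_sqrt -sqrtr_sqr ler_wsqrtr//.
by rewrite lerDl sqr_ge0.
Qed.

Lemma normr_sim_le z : `|sim z| <= sabs z.
Proof.
rewrite sabs_sqrt -sqrtr_sqr ler_wsqrtr//.
by rewrite lerDr sqr_ge0.
Qed.

(* The imaginary part [b] is discarded over the reals. *)
Definition scalar_of (k' : scalar_kind) : R -> R -> scalars R k' :=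
  match k' with
  | RealScalars => fun a _ => a | ComplexScalars => fun a b => (a +i* b)%C
  end.

Lemma sre_scalar_of a b : sre (scalar_of k a b : K) = a.
Proof. by case: k. Qed.

Lemma sreN z : sre (- z) = - sre z.
Proof. by move: z; rewrite /scalars; case: k => // -[]. Qed.

Lemma simN z : sim (- z) = - sim z.
Proof. by move: z; rewrite /scalars; case: k => [x|[]] //=; rewrite oppr0. Qed.

Lemma sre_of_real a : sre (of_real k a : K) = a.
Proof. by case: k. Qed.

Lemma sim_of_real a : sim (of_real k a : K) = 0.
Proof. by case: k. Qed.

Lemma scalar_ofD a b a' b' :
  scalar_of k (a + a') (b + b') = scalar_of k a b + scalar_of k a' b'.
Proof. by case: k. Qed.

Lemma scalar_ofM z a b :
  scalar_of k (sre z * a - sim z * b) (sre z * b + sim z * a) =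
  z * scalar_of k a b.
Proof. by move: z; rewrite /scalars; case: k => [x|[x y]] //=; rewrite mul0r subr0. Qed.

Lemma sabs_scalar_of a b : sabs (scalar_of k a b : K) <= `|a| + `|b|.
Proof.
apply: le_trans (sabs_le _) _.
by case: k => //=; rewrite normr0 lerD2l.
Qed.

Lemma ler_sabs_scalar_ofB z a b :
  sabs (scalar_of k a b - z) <= `|a - sre z| + `|b - sim z|.
Proof.
apply: le_trans (sabs_le _) _; rewrite sreD simD sreN simN.
move: z; rewrite /scalars; case: k => [x|[x y]] //=.
by rewrite subr0 normr0 lerD2l.
Qed.

Lemma of_real_gt0 (e : R) : (0 < (of_real k e : K)) = (0 < e).
Proof. by rewrite !lt_def -(of_real0 R k) ler_of_real (inj_eq (@of_real_inj R k)). Qed.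

(** A positive scalar is real. This turns radii of balls, which live in the field, into real
    numbers. *)
Lemma gt0_of_real z : 0 < z -> z = of_real k (sabs z) /\ 0 < sabs z.
Proof.
move=> z0; have zE : z = of_real k (sabs z) by rewrite -sabsE gtr0_norm.
by split=> //; rewrite -of_real_gt0 -zE.
Qed.

Lemma ltr_of_real a b : ((of_real k a : K) < of_real k b) = (a < b).
Proof. by rewrite !lt_def ler_of_real (inj_eq (@of_real_inj R k)). Qed.

Lemma cvg_sabsP T (F : set_system T) {FF : Filter F} (f : T -> K) z :
  f @ F --> z <-> forall e : R, 0 < e -> \forall t \near F, sabs (z - f t) < e.
Proof.
split=> [/cvgrPdist_lt fz e e0|fz].
  have := fz (of_real k e); rewrite of_real_gt0 => /(_ e0).
  by apply: filterS => t; rewrite sabsE ltr_of_real.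
apply/cvgrPdist_lt => e e0; have [eE e1] := @gt0_of_real e e0; move: (fz _ e1).
by apply: filterS => t tz; rewrite eE [X in X < _](sabsE (z - f t)) ltr_of_real.
Qed.

Lemma continuous_sre : continuous (@sre R k : K -> R).
Proof.
move=> z; apply/(@cvgrPdist_lt _ _ _ (nbhs z)) => e e0.
have := iffLR (@cvg_sabsP _ (nbhs z) (nbhs_filter z) id z) (@cvg_id _ _) e e0.
apply: filterS => w; apply: le_lt_trans.
by apply: le_trans (normr_sre_le _); rewrite sreD sreN.
Qed.

End scalar_lemmas.

(** * The dual unit ball and its weak-star topology *)

Section dual_ball_lemmas.
Context (R : realType) (k : scalar_kind).
Local Notation K := (scalars R k).
Variable V : normedModType K.

(** For nonzero [u], rescaling to norm one reduces the bound to the supremum defining the dual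
    norm. *)
Lemma dual_ball_le (l : V -> K) (u : V) : dual_ball V l -> sabs (l u) <= sre `|u|.
Proof.
move=> [dl nl]; have [l_lin _] := dl.
have l0 : l 0 = 0.
  by have := l_lin (-1) 0 0; rewrite scaler0 addr0 mulN1r addNr.
have [->|u0] := eqVneq u 0; first by rewrite l0 normr0 /sabs normr0.
have [uE u1] : `|u| = of_real k (sabs `|u|) /\ 0 < sabs `|u|.
  by apply: gt0_of_real; rewrite normr_gt0.
have lZ a v : l (a *: v) = a * l v.
  by have := l_lin a v 0; rewrite !addr0 l0 addr0.
have : sabs (l (`|u|^-1 *: u)) <= 1.
  apply: le_trans nl; apply: ub_le_sup; first by case: (dual_bounded dl).
  by exists (`|u|^-1 *: u) => //=; rewrite normrZ normfV normr_id mulVf ?normr_eq0.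
rewrite lZ sabsM => h.
have -> : sabs (l u) = sabs `|u| * (sabs `|u|^-1 * sabs (l u)).
  rewrite mulrA -sabsM divff ?normr_eq0// /sabs normr1.
  by rewrite -[1](_ : of_real k 1 = 1) ?sre_of_real ?mul1r//; case: k.
have -> : sre `|u| = sabs `|u| * 1 by rewrite mulr1 /sabs normr_id.
by rewrite ler_wpM2l// ltW.
Qed.

(** The pointwise bound yields continuity as well, because [l u - l v = l (u - v)]. *)
Lemma dual_ballI (l : V -> K) : scalar l ->
  (forall u, sabs (l u) <= sre `|u|) -> dual_ball V l.
Proof.
move=> l_lin l1; split; last first.
  apply: ge_sup; first by exists (sabs (l 0)), 0 => //=; rewrite normr0 ler01.
  move=> _ [u /= u1 <-]; apply: le_trans (l1 u) _.
  have -> : 1 = sre (of_real k 1 : K) by rewrite sre_of_real.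
  have [->|u0] := eqVneq u 0; first by rewrite normr0 sre0 sre_of_real.
  have [uE u2] : `|u| = of_real k (sabs `|u|) /\ 0 < sabs `|u|.
    by apply: gt0_of_real; rewrite normr_gt0.
  move: u1; rewrite uE !sre_of_real.
  by rewrite [1](_ : 1 = of_real k 1) ?ler_of_real//; case: k.
split => // u; apply/cvg_sabsP => e e0; near=> v.
have -> : l u - l v = l (u - v).
  by rewrite -scaleN1r addrC -(l_lin (-1)) scaleN1r addrC.
apply: le_lt_trans (l1 _) _.
near: v; have /cvgrPdist_lt/(_ (of_real k e)) : id @ nbhs u --> u by exact: cvg_id.
rewrite of_real_gt0 => /(_ e0); apply: filterS => v /=.
have [->|u0] := eqVneq (u - v) 0; first by rewrite normr0 sre0.
have [uE u2] : `|u - v| = of_real k (sabs `|u - v|) /\ 0 < sabs `|u - v|.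
  by apply: gt0_of_real; rewrite normr_gt0.
by rewrite uE sre_of_real ltr_of_real.
Unshelve. all: by end_near. Qed.

(** Convergence in a supremum of topologies is convergence in each of them, and each is initial for
    one evaluation. *)
Lemma cvg_weak_star (F : set_system (weak_star_ball V)) (FF : Filter F)
    (l : weak_star_ball V) :
  (forall u, (fun m : dual_ball V => val m u) @ F --> (val (l : dual_ball V) u : K)) ->
  F --> l.
Proof.
move=> h; apply/cvg_sup => u U [/= _ [[W oW <-] Wl] WU].
by apply: filterS WU _; apply: h; exact: open_nbhs_nbhs.
Qed.

Lemma weak_star_eval_continuous (u : V) :
  continuous (fun m : weak_star_ball V => val (m : dual_ball V) u : K).
Proof.
move=> l W Wl.
have h := iffLR (@cvg_sup _ _ (fun u : V => Topological.class
  (initial_topology (fun l : dual_ball V => val l u))) (nbhs l) l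
  (nbhs_filter l)) (fun A h => h) u.
apply: h.
exact: (@initial_continuous _ _ (fun l : dual_ball V => val l u)).
Qed.

End dual_ball_lemmas.

(** * The Banach-Alaoglu theorem *)

Lemma ultra_compact_cvg (T : Type) (X : topologicalType) (F : set_system T)
    (f : T -> X) (C : set X) : UltraFilter F -> compact C -> F (f @^-1` C) ->
  exists2 a, C a & f @ F --> a.
Proof.
move=> FU cC FC; have FP := @ultra_proper _ _ FU.
have [a [Ca cla]] := cC (f @ F) _ FC; exists a => // A Aa.
(* An ultrafilter that misses the preimage of [A] contains that of its complement, so [a] could not
   be a cluster point. *)
have [//|FnA] := in_ultra_setVsetC (f @^-1` A) FU.
by have [x [] /=] := cla (~` A) A FnA Aa.
Qed.

Section banach_alaoglu.
Context (R : realType) (k : scalar_kind).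
Local Notation K := (scalars R k).
Variable V : normedModType K.

(** Along an ultrafilter the values at each [u] converge, being bounded by the norm of [u]. The
    pointwise limit is again linear and satisfies the same bound. *)
Lemma compact_weak_star_ball : compact [set: weak_star_ball V].
Proof.
rewrite compact_ultra => F FU _; have FP := @ultra_proper _ _ FU.
(* [p] will be [sre] and then [sim], so only compactness of real segments is needed. *)
have lim (p : K -> R) u : (forall z, `|p z| <= sabs z) ->
    exists a : R, (fun m : weak_star_ball V => p (val (m : dual_ball V) u)) @ F --> a.
  move=> ple.
  have [||a _ fa] := @ultra_compact_cvg _ _ F
      (fun m : weak_star_ball V => p (val (m : dual_ball V) u))
      `[- sre `|u|, sre `|u|] FU; last by exists a.
    exact: segment_compact.
  apply: filterE => m /=; rewrite in_itv/= -ler_norml.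
  by apply: le_trans (ple _) (dual_ball_le _ _); exact/set_mem/(valP (m : dual_ball V)).
have /choice[a aP] u := lim (@sre R k) u (@normr_sre_le R k).
have /choice[b bP] u := lim (@sim R k) u (@normr_sim_le R k).
pose l u : K := scalar_of k (a u) (b u).
have lP u : (fun m : weak_star_ball V => val (m : dual_ball V) u : K) @ F --> l u.
  apply/cvg_sabsP => e e0; have e2 : 0 < e / 2 by rewrite divr_gt0.
  move: (aP u) (bP u) => /cvgrPdist_lt/(_ _ e2) ha /cvgrPdist_lt/(_ _ e2) hb.
  apply: filterS2 ha hb => m ha hb.
  by rewrite (le_lt_trans (ler_sabs_scalar_ofB _ _ _))// [e]splitr ltrD.
(* Both sides of the linearity identity are limits of the same function. *)
have l_lin : scalar l.
  move=> c u v.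
  apply: (@cvg_unique K (@norm_hausdorff K K) ((fun m : weak_star_ball V =>
    val (m : dual_ball V) (c *: u + v) : K) @ F)).
  - exact: lP.
  - rewrite /= (_ : (fun m : weak_star_ball V => _) = (fun m : weak_star_ball V =>
        c * val (m : dual_ball V) u + val (m : dual_ball V) v)); last first.
      apply/funext => m; have /set_mem[[mlin _] _] := valP (m : dual_ball V).
      exact: mlin.
    apply: cvgD (lP v); apply: cvgM (lP u); exact: cvg_cst.
have l1 u : sabs (l u) <= sre `|u|.
  apply/ler_addgt0Pl => e e0.
  have /cvg_sabsP/(_ _ e0)/filter_ex[m hm] := lP u.
  rewrite -[l u](subrK (val (m : dual_ball V) u)).
  apply: le_trans (ler_sabsD _ _) _; apply: lerD; first exact: ltW.
  by apply: dual_ball_le; exact/set_mem/(valP (m : dual_ball V)).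
pose L : weak_star_ball V := exist _ l (mem_set (dual_ballI l_lin l1)).
by exists L; split => //; apply: cvg_weak_star => u; exact: lP.
Qed.

End banach_alaoglu.

(** * Continuity of translation for real integrable functions *)

Section translation_continuity.
Variables (G : topologicalGroupType) (R : realType).
Variables (mu : {measure set (borel G) -> \bar R}) (hmu : left_haar mu).
Implicit Types (f h : borel G -> R) (A U : set G).

Local Notation integrable f := (mu.-integrable setT (EFin \o f)).

Definition transl_dist f (g : G) : \bar R :=
  (\int[mu]_x (`|f (ltransl g x) - f x|)%:E)%E.

Definition L1_transl_continuous f :=
  forall e : R, 0 < e -> \forall g \near (1%g : G), (transl_dist f g < e%:E)%E.

Lemma measurable_transl_sub f g : integrable f ->
  measurable_fun setT (fun x => `|f (ltransl g x) - f x|).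
Proof.
move=> fi; have mf : measurable_fun setT f.
  by apply/measurable_EFinP; exact: measurable_int fi.
apply: measurableT_comp => //; apply: measurable_funB => //.
exact: (measurableT_comp mf (measurable_ltransl g)).
Qed.

(** Passing from the translate of [f] to that of [h], then to [h], then to [f] costs the distance
    from [f] to [h] twice, by left invariance. *)
Lemma transl_dist_approx f h g : integrable f -> integrable h ->
  (transl_dist f g <=
   \int[mu]_x (`|f x - h x|)%:E + (transl_dist h g + \int[mu]_x (`|f x - h x|)%:E))%E.
Proof.
move=> fi hi.
have mf : measurable_fun setT f by apply/measurable_EFinP; exact: measurable_int fi.
have mh : measurable_fun setT h by apply/measurable_EFinP; exact: measurable_int hi.
have mfh : measurable_fun setT (fun x => `|f x - h x|).
  by apply: measurableT_comp => //; exact: measurable_funB.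
(* The first error term is moved to the point [g x], so that the inequality holds pointwise. *)
rewrite -[X in (_ <= X + _)%E](integral_ltransl hmu g (f := fun x => (`|f x - h x|)%:E)).
- rewrite -ge0_integralD//; last 2 first.
  + by apply/measurable_EFinP; exact: measurable_transl_sub.
  + exact/measurable_EFinP.
  rewrite -ge0_integralD//; last 3 first.
  + by apply/measurable_EFinP; apply: (measurableT_comp mfh); exact: measurable_ltransl.
  + by move=> x _; rewrite adde_ge0.
  + apply/measurable_EFinP; apply: measurable_funD => //.
    exact: measurable_transl_sub.
  apply: ge0_le_integral => //.
  + by apply/measurable_EFinP; exact: measurable_transl_sub.
  + apply/measurable_EFinP; apply: measurable_funD => //.
      by apply: (measurableT_comp mfh); exact: measurable_ltransl.
    apply: measurable_funD => //; exact: measurable_transl_sub.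
  + move=> x _; rewrite -!EFinD lee_fin.
    rewrite [in leRHS](distrC (f x)) addrA.
    have -> : f (ltransl g x) - f x = (f (ltransl g x) - h (ltransl g x))
        + (h (ltransl g x) - h x) + (h x - f x) by lra.
    by rewrite (le_trans (ler_normD _ _))// lerD2r ler_normD.
- exact/measurable_EFinP.
- by move=> x; rewrite lee_fin.
Qed.

Lemma L1_transl_continuous_approx f : integrable f ->
  (forall e : R, 0 < e -> exists h, [/\ integrable h, L1_transl_continuous h &
     (\int[mu]_x (`|f x - h x|)%:E < e%:E)%E]) ->
  L1_transl_continuous f.
Proof.
move=> fi approx e e0; have e3 : 0 < e / 3 by rewrite divr_gt0.
have [h [hi hc fh]] := approx _ e3.
apply: filterS (hc _ e3) => g hg.
apply: le_lt_trans (transl_dist_approx g fi hi) _.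
rewrite (_ : e%:E = (e / 3)%:E + ((e / 3)%:E + (e / 3)%:E))%E; last first.
  by rewrite -!EFinD; congr (_%:E); lra.
by rewrite lteD// lteD.
Qed.

Lemma L1_transl_continuousD f h : integrable f -> integrable h ->
  L1_transl_continuous f -> L1_transl_continuous h ->
  L1_transl_continuous (fun x => f x + h x).
Proof.
move=> fi hi fc hc e e0; have e2 : 0 < e / 2 by rewrite divr_gt0.
apply: filterS2 (fc _ e2) (hc _ e2) => g fg hg.
apply: (@le_lt_trans _ _ (transl_dist f g + transl_dist h g)%E); last first.
  by rewrite [e]splitr EFinD lteD.
rewrite /transl_dist -ge0_integralD//; last 2 first.
- by apply/measurable_EFinP; exact: measurable_transl_sub.
- by apply/measurable_EFinP; exact: measurable_transl_sub.
apply: ge0_le_integral => //.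
- apply/measurable_EFinP; apply: measurable_transl_sub.
  by apply: eq_integrable (integrableD measurableT fi hi).
- by apply/measurable_EFinP; apply: measurable_funD; exact: measurable_transl_sub.
- by move=> x _; rewrite -EFinD lee_fin opprD addrACA ler_normD.
Qed.

Lemma L1_transl_continuousZ f (c : R) : integrable f ->
  L1_transl_continuous f -> L1_transl_continuous (fun x => c * f x).
Proof.
(* Dividing by [|c| + 1] rather than [|c|] covers the case [c = 0]. *)
move=> fi fc e e0; have c1 : 0 < `|c| + 1 by rewrite ltr_wpDl.
apply: filterS (fc _ (divr_gt0 e0 c1)) => g fg.
apply: (@le_lt_trans _ _ ((`|c| + 1)%:E * transl_dist f g)%E); last first.
  by rewrite -lte_pdivlMl// -EFinM mulrC.
rewrite /transl_dist -ge0_integralZl_EFin//; last first.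
  by apply/measurable_EFinP; exact: measurable_transl_sub.
apply: ge0_le_integral => //.
- apply/measurable_EFinP; apply: measurable_transl_sub.
  by apply: eq_integrable (integrableZl measurableT c fi).
- apply/measurable_EFinP; apply: measurable_funM => //; exact: measurable_transl_sub.
- by move=> x _; rewrite -EFinM lee_fin -mulrBr normrM ler_wpM2r// lerDl.
Qed.

(** Continuity of multiplication at each [(1, x)] gives a neighborhood of [1] depending on [x];
    compactness of [C] makes it uniform. *)
Lemma near_transl_compact (C U : set G) : compact C -> open U -> C `<=` U ->
  \forall g \near (1%g : G), C `<=` [set x | U (g * x)%g].
Proof.
move=> /compact_near_coveringP cC oU CU.
apply: (cC G (nbhs (1%g : G)) (fun g x => U (g * x)%g)) => x Cx.
have Ux : nbhs (1 * x)%g U by apply: open_nbhs_nbhs; split => //; rewrite mul1g; exact: CU.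
have [[V W] /= [V1 Wx] VW] := @mulg_continuous G (1%g, x) U Ux.
by exists (W, V) => //= -[y g] /= [Wy Vg]; apply: (VW (g, y)).
Qed.

Lemma integrable_indic A : measurable (A : set (borel G)) -> (mu A < +oo)%E ->
  integrable (\1_A : borel G -> R).
Proof.
move=> mA A_fin; apply/integrableP; split.
  by apply/measurable_EFinP; exact: measurable_indic.
rewrite (eq_integral (fun x : borel G => (\1_A x)%:E)); last first.
  by move=> x _; rewrite /= ger0_norm.
by rewrite integral_indic// setIT.
Qed.


(** The integrand is the indicator of the symmetric difference of [A] and its preimage. These have
    equal finite measure, hence so do the two halves of the difference. *)
Lemma transl_dist_indic A g : measurable (A : set (borel G)) -> (mu A < +oo)%E ->
  transl_dist (\1_A : borel G -> R) g =
  (mu (A `\` ltransl g @^-1` A) + mu (A `\` ltransl g @^-1` A))%E.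
Proof.
move=> mA A_fin; pose P : set (borel G) := ltransl g @^-1` A.
have mP : measurable P.
  by rewrite -[P]setTI; exact: measurable_ltransl.
have muP : mu P = mu A by exact: haar_preimage.
rewrite -/P [X in (_ + X)%E](_ : _ = mu (P `\` A)); last first.
  have P_fin : (mu P < +oo)%E by rewrite muP.
  rewrite (measureD mA mP A_fin) (measureD mP mA P_fin) setIC.
  by congr (_ - _)%E; exact/esym/muP.
rewrite /transl_dist; transitivity
  (\int[mu]_x ((\1_(A `\` P) x : R)%:E + (\1_(P `\` A) x : R)%:E))%E.
  apply: eq_integral => x _; rewrite -EFinD; congr (_%:E).
  rewrite !indicE !in_setD /ltransl.
  have -> : ((g * x)%g \in A) = (x \in P) by [].
  by do 2!case: (x \in _);
    rewrite /= ?subrr ?sub0r ?subr0 ?normrN ?normr1 ?normr0 ?addr0 ?add0r.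
rewrite ge0_integralD//.
- by rewrite !integral_indic ?setIT//; exact: measurableD.
- by apply/measurable_EFinP; apply: measurable_indic; exact: measurableD.
- by apply/measurable_EFinP; apply: measurable_indic; exact: measurableD.
Qed.

Lemma measurable_open (U : set G) : open U -> measurable (U : set (borel G)).
Proof. exact: sub_sigma_algebra. Qed.

Lemma measurable_compact (C : set G) : hausdorff_space G -> compact C ->
  measurable (C : set (borel G)).
Proof.
move=> hG cC; rewrite -[C]setCK; apply: measurableC; apply: measurable_open.
by rewrite openC; exact: compact_closed.
Qed.

(** By inner regularity a compact [C] fills [U] up to [e / 2]. For [g] near [1] the translate [g C]
    stays in [U], so what [U] loses lies in the complement of [C] in [U]. *)
Lemma L1_transl_continuous_open U : hausdorff_space G -> open U ->
  (mu U < +oo)%E -> L1_transl_continuous (\1_U : borel G -> R).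
Proof.
move=> hG oU U_fin e e0; have e2 : 0 < e / 2 by rewrite divr_gt0.
have mU := measurable_open oU.
have Ufn : mu U \is a fin_num by rewrite ge0_fin_numE.
have [_ [C [cC CU] <-] muC] : exists2 x, [set mu C | C in [set C : set G |
    compact C /\ C `<=` U]] x & (mu U - (e / 2)%:E < x)%E.
  rewrite (haar_inner hmu oU); apply: ub_ereal_sup_adherent => //.
  by rewrite -(haar_inner hmu oU).
have mC := measurable_compact hG cC.
apply: filterS (near_transl_compact cC oU CU) => g gC.
rewrite transl_dist_indic// [e]splitr EFinD.
suff : (mu (U `\` ltransl g @^-1` U) < (e / 2)%:E)%E by move=> h; rewrite lteD.
apply: (@le_lt_trans _ _ (mu (U `\` C))).
  apply: le_measure; rewrite ?inE.
  - apply: measurableD => //; rewrite -[X in measurable X]setTI.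
    exact: measurable_ltransl.
  - exact: measurableD.
  - exact: setDS.
rewrite measureD// setIidr//.
have Cfn : mu C \is a fin_num by rewrite ge0_fin_numE// (haar_compact hmu).
by rewrite lteBlDr// -lteBlDl.
Qed.

(** Outer regularity approximates [A] in the integral norm by open sets of finite measure. *)
Lemma L1_transl_continuous_indic A : hausdorff_space G ->
  measurable (A : set (borel G)) -> (mu A < +oo)%E ->
  L1_transl_continuous (\1_A : borel G -> R).
Proof.
move=> hG mA A_fin; apply: L1_transl_continuous_approx; first exact: integrable_indic.
move=> e e0.
have Afn : mu A \is a fin_num by rewrite ge0_fin_numE.
have [_ [U [oU AU] <-] muU] : exists2 x, [set mu U | U in [set U : set G |
    open U /\ A `<=` U]] x & (x < mu A + e%:E)%E.
  rewrite (haar_outer hmu mA); apply: lb_ereal_inf_adherent => //.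
  by rewrite -(haar_outer hmu mA).
have mU := measurable_open oU.
have U_fin : (mu U < +oo)%E.
  by apply: lt_le_trans muU _; rewrite leey.
exists (\1_U : borel G -> R).
split; [exact: integrable_indic|exact: L1_transl_continuous_open|].
rewrite [X in (X < _)%E](_ : _ = mu (U `\` A)).
  by rewrite measureD// setIidr// lteBlDl.
transitivity (\int[mu]_x ((\1_(U `\` A) x : R)%:E))%E; last first.
  by rewrite integral_indic ?setIT//; exact: measurableD.
apply: eq_integral => x _; congr (_%:E); rewrite !indicE in_setD.
have : x \in A -> x \in U by rewrite !inE; exact: AU.
case: (x \in A) => [/(_ isT) ->|_]; first by rewrite subrr normr0.
by rewrite sub0r normrN; case: (x \in U); rewrite /= ?normr1 ?normr0.
Qed.

Lemma L1_transl_continuous0 : L1_transl_continuous (fun=> 0).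
Proof.
move=> e e0; apply: nearW => g; rewrite /transl_dist.
rewrite (eq_integral (cst 0%E)) ?integral0// => x _.
by rewrite subrr normr0.
Qed.

Lemma L1_transl_continuous_sum (I : Type) (s : seq I) (F : I -> borel G -> R) :
  (forall i, integrable (F i)) -> (forall i, L1_transl_continuous (F i)) ->
  integrable (fun x => \sum_(i <- s) F i x) /\
  L1_transl_continuous (fun x => \sum_(i <- s) F i x).
Proof.
move=> Fi Fc; elim: s => [|i s [IHi IHc]].
  have -> : (fun x => \sum_(i <- [::]) F i x) = (fun=> 0 : R).
    by apply/funext => x; rewrite big_nil.
  by split; [exact: integrable0|exact: L1_transl_continuous0].
have -> : (fun x => \sum_(i <- i :: s) F i x) = (fun x => F i x + \sum_(i <- s) F i x).
  by apply/funext => x; rewrite big_cons.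
split; last exact: L1_transl_continuousD.
by apply: eq_integrable (integrableD measurableT (Fi i) IHi).
Qed.

(** This is Markov's inequality: [|y|] times the indicator of the level set is at most [|f|]. *)
Lemma integrable_level_set f (y : R) : integrable f -> y != 0 ->
  (mu (f @^-1` [set y]) < +oo)%E.
Proof.
move=> /integrableP[/measurable_EFinP mf f_fin] y0.
have mP : measurable (f @^-1` [set y]).
  by rewrite -[X in measurable X]setTI; exact: mf.
suff : (`|y|%:E * mu (f @^-1` [set y]) < +oo)%E.
  by rewrite -lte_pdivlMl ?normr_gt0// mulry gtr0_sg ?mul1e ?invr_gt0 ?normr_gt0.
apply: le_lt_trans f_fin; rewrite -[X in mu X]setIT -integral_indic//.
rewrite -ge0_integralZl_EFin//; last first.
  by apply/measurable_EFinP; exact: measurable_indic.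
apply: ge0_le_integral => //.
- by apply/measurable_EFinP; apply: measurable_funM => //; exact: measurable_indic.
- by apply/measurable_EFinP; exact: measurableT_comp.
- move=> x _; rewrite -EFinM lee_fin indicE.
  by have [/set_mem -> |_] := boolP (x \in _); rewrite ?mulr1// mulr0.
Qed.

Lemma L1_transl_continuous_sfun (f : {sfun borel G >-> R}) : hausdorff_space G ->
  integrable f -> L1_transl_continuous f.
Proof.
move=> hG fi.
pose F (y : R) (x : borel G) := y * \1_(f @^-1` [set y]) x.
have mP y : measurable (f @^-1` [set y]) by exact: measurable_sfunP.
have Fi y : integrable (F y) /\ L1_transl_continuous (F y).
  (* The level set of [0] may have infinite measure, but its term in the sum vanishes. *)
  have [->|y0] := eqVneq y 0.
    have -> : F 0 = fun=> 0 by apply/funext => x; rewrite /F mul0r.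
    by split; [exact: integrable0|exact: L1_transl_continuous0].
  have Pi := integrable_indic (mP y) (integrable_level_set fi y0).
  split; first exact: eq_integrable (integrableZl measurableT y Pi).
  apply: L1_transl_continuousZ => //; apply: L1_transl_continuous_indic => //.
  exact: integrable_level_set.
have -> : (f : borel G -> R) = fun x => \sum_(y <- fset_set (range f)) F y x.
  by apply/funext => x; rewrite fimfunE fsbig_finite.
by apply: (L1_transl_continuous_sum _ _ _).2 => y; case: (Fi y).
Qed.

Lemma integrable_L1_transl_continuous f : hausdorff_space G ->
  integrable f -> L1_transl_continuous f.
Proof.
move=> hG fi; apply: L1_transl_continuous_approx => // e e0.
have [h [hi _ hf]] := approximation_sfun_integrable measurableT fi.
have [n _ hn] : \forall n \near \oo,
    (\int[mu]_(z in setT) `|(EFin \o f) z - (h n z)%:E| < e%:E)%E.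
  apply: (hf [set x | (x < e%:E)%E]); apply: open_nbhs_nbhs.
  by split; [exact: open_ereal_lt_ereal|rewrite /= lte_fin].
exists (h n); split => //; first exact: L1_transl_continuous_sfun.
by have := hn n (leqnn n).
Qed.

End translation_continuity.

(** * Continuity of translation on classes of integrable functions *)

Section L1_translation.
Context (G : topologicalGroupType) (R : realType) (k : scalar_kind).
Variables (mu : {measure set (borel G) -> \bar R}) (hmu : left_haar mu).
Local Notation K := (scalars R k).

Lemma L1_ltransl_near1 (u : L1 k mu) (e : R) : hausdorff_space G -> 0 < e ->
  \forall g \near (1%g : G), L1norm1 (L1_ltransl hmu g u - u) < e.
Proof.
move=> hG e0; have e2 : 0 < e / 2 by rewrite divr_gt0.
have [fr fi] := L1funP (repr u).
apply: filterS2 (integrable_L1_transl_continuous hmu hG fr e2)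
  (integrable_L1_transl_continuous hmu hG fi e2) => g hr hi.
have -> : L1_ltransl hmu g u - u =
    L1class (L1fun_ltransl hmu g (repr u) - repr u : L1fun k mu).
  by rewrite -[u in _ - u]L1classK -[in RHS]scaleN1r L1classD L1classZ scaleN1r.
rewrite L1norm1E -lte_fin fineK; last first.
  exact: (integrable_fin_num measurableT (integrable_sabs _)).
apply: (@le_lt_trans _ _ (transl_dist mu (@sre R k \o repr u) g +
    transl_dist mu (@sim R k \o repr u) g)%E); last by rewrite [e]splitr EFinD lteD.
rewrite /transl_dist -ge0_integralD//; last 2 first.
- by apply/measurable_EFinP; exact: (measurable_transl_sub g fr).
- by apply/measurable_EFinP; exact: (measurable_transl_sub g fi).
apply: ge0_le_integral => //.
- by move=> x _; rewrite lee_fin sabs_ge0.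
- by apply/measurable_EFinP; exact: measurable_sabs.
- by apply/measurable_EFinP; apply: measurable_funD;
    [exact: (measurable_transl_sub g fr)|exact: (measurable_transl_sub g fi)].
- move=> x _; rewrite -EFinD lee_fin L1funB.
  by apply: le_trans (sabs_le _) _; rewrite sreD simD sreN simN.
Qed.

(** M g h (u : L1 k mu) : Precomposition reverses the order of products; dualizing reverses it once
    more, which makes [haar_action] a left action. *)
Lemma L1_ltranslM g h (u : L1 k mu) :
  L1_ltransl hmu g (L1_ltransl hmu h u) = L1_ltransl hmu (h * g)%g u.
Proof.
rewrite -[u]L1classK !L1_ltranslE; congr L1class; apply: val_inj.
by apply/funext => x; rewrite /= /ltransl mulgA.
Qed.

Lemma L1_ltransl_near (u : L1 k mu) (g0 : G) (e : R) : hausdorff_space G -> 0 < e ->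
  \forall g \near g0, L1norm1 (L1_ltransl hmu g u - L1_ltransl hmu g0 u) < e.
Proof.
move=> hG e0.
have cg : continuous (fun g : G => (g * g0^-1)%g).
  move=> x; apply: (@continuous_comp _ _ _ (fun y : G => (y, (g0^-1)%g))
    (fun y : G * G => (y.1 * y.2)%g)); last exact: mulg_continuous.
  by apply: cvg_pair; [exact: cvg_id|exact: cvg_cst].
have : \forall g \near g0, L1norm1 (L1_ltransl hmu (g * g0^-1)%g u - u) < e.
  have := cg g0; rewrite /continuous_at mulgV.
  by move=> /(_ _ (L1_ltransl_near1 u hG e0)).
apply: filterS => g /=.
(* Translation by [g0] is a linear isometry, so continuity at [g0] reduces to continuity at [1]. *)
suff -> : L1_ltransl hmu g u - L1_ltransl hmu g0 u =
    L1_ltransl hmu g0 (L1_ltransl hmu (g * g0^-1)%g u - u).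
  by move=> h; have := norm_L1_ltransl hmu g0 (L1_ltransl hmu (g * g0^-1)%g u - u);
    rewrite !normL1E => /of_real_inj ->.
have -> : L1_ltransl hmu g u = L1_ltransl hmu g0 (L1_ltransl hmu (g * g0^-1)%g u).
  by rewrite L1_ltranslM mulgVK.
by rewrite -scaleN1r addrC -L1_ltransl_linear scaleN1r addrC.
Qed.

End L1_translation.


(** * Uniform refinements and vanishing of the entropy *)

Section tube.

Lemma compact_subfamily_cover (X : topologicalType) (B : set (set X)) :
  compact [set: X] -> B `<=` open -> \bigcup_(A in B) A = [set: X] ->
  exists V, [/\ finite_set V, V `<=` B & \bigcup_(A in V) A = [set: X]].
Proof.
move=> /compact_near_coveringP cX Bop Bcov.
(* [F] consists of the properties that hold for all sufficiently large finite subfamilies of [B].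
   Each point is covered eventually along [F], so compactness gives one subfamily covering all
   points. *)
pose F : set_system (set (set X)) := [set Q | exists D, [/\ finite_set D, D `<=` B &
  forall E, finite_set E -> E `<=` B -> D `<=` E -> Q E]].
have FF : Filter F.
  split=> [|P Q [D [fD DB DP]] [E [fE EB EQ]]|P Q PQ [D [fD DB DP]]].
  - by exists set0; split.
  - exists (D `|` E); split; first by rewrite finite_setU.
      by move=> A [/DB|/EB].
    move=> A fA AB; rewrite subUset => -[DA EA]; split; [exact: DP|exact: EQ].
  - by exists D; split => // E fE EB DE; apply/PQ/DP.
have [x _|D [fD DB DP]] := cX (set (set X)) F (fun D x => exists2 A, D A & A x) FF.
  have [A BA Ax] : (\bigcup_(A in B) A) x by rewrite Bcov.
  exists (A, [set E | E A]).
    split=> /=; first by apply: open_nbhs_nbhs; split => //; exact: Bop.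
    exists [set A]; split => [|_ -> //|E _ _]; first exact: finite_set1.
    by apply.
  by move=> -[y E] /= [Ay EA]; exists A.
exists D; split => //; apply/seteqP; split => // x _.
by have [A DA Ax] := DP _ fD DB (@subset_refl _ D) x I; exists A.
Qed.

Variables (R : realType) (G : topologicalGroupType) (X : topologicalType).
Variable alpha : G -> X -> X.

(** A tube lemma: by compactness of [G], each point of [X] has an open neighborhood that every [g]
    maps into some member of [U]. Finitely many of these cover [X]. *)
Lemma finite_uniform_refinement U : compact [set: G] -> compact [set: X] ->
  continuous (fun p : G * X => alpha p.1 p.2) -> @finite_open_cover X U ->
  exists2 V, finite_open_cover V & refines alpha [set: G] U V.
Proof.
move=> /compact_near_coveringP cG cX calpha [fU Uop Ucov].
pose B := [set W : set X | open W /\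
  forall g, exists2 A, U A & alpha g @` W `<=` A].
have [W [] //||V [fV VB Vcov]] := @compact_subfamily_cover X B cX.
  apply/seteqP; split => // x _.
  (* Near covering along the filter of small sets around [x] gives one neighborhood that serves all
     [g]. *)
  have : \forall W \near powerset_filter_from (nbhs x),
      [set: G] `<=` (fun g => exists2 A, U A & alpha g @` W `<=` A).
    apply: cG => g _.
    have [A UA Ax] : (\bigcup_(A in U) A) (alpha g x) by rewrite Ucov.
    have [[N M] /= [Ng Mx] NMA] : nbhs (g, x) [set p | A (alpha p.1 p.2)].
      by apply: calpha; apply: open_nbhs_nbhs; split => //; exact: Uop.
    exists (N, [set W | W `<=` M]); first by split => //; exact: small_set_sub.
    move=> -[h W] /= [Nh WM]; exists A => // _ [y Wy <-].
    by apply: (NMA (h, y)); split => //; exact: WM.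
  move=> /near_powerset_filter_fromP[|W Wx WP].
    move=> C D CD h g gT; have [A UA DA] := h g gT.
    by exists A => //; apply: subset_trans DA; exact: image_subset.
  move: Wx; rewrite nbhsE => -[Q [oQ Qx] QW]; exists Q => //; split => // g.
  have [A UA WA] := WP g I; exists A => //; apply: subset_trans WA.
  exact: image_subset.
exists V; first by split => // W /VB[].
by move=> g W _ /VB[_ /(_ g)].
Qed.

(** The point [x0] rules out the empty cover, so the logarithms below are nonnegative. *)
Lemma cover_number_ge1 S U (x0 : X) : (1%:E <= cover_number R alpha S U)%E.
Proof.
apply: le_ereal_inf_tmp => _ [V [[fV _ Vcov] _] <-].
rewrite lee_fin ler1n cardfs_gt0; apply/eqP => V0.
have [A VA _] : (\bigcup_(A in V) A) x0 by rewrite Vcov.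
by move: VA; rewrite -(fset_setK fV) V0 /=.
Qed.

Lemma entropy_eq0 (x0 : X) S :
  (forall U, @finite_open_cover X U ->
     exists2 V, finite_open_cover V & refines alpha [set: G] U V) ->
  entropy R alpha S = 0%E.
Proof.
(* The trivial cover shows that the supremum is over a nonempty set, hence is [0] and not [-oo]. *)
move=> refine; have U0 : @finite_open_cover X [set setT].
  split; first exact: finite_set1.
    by move=> _ ->; exact: openT.
  by rewrite bigcup_set1.
suff h U : @finite_open_cover X U -> cover_entropy R alpha S U = 0%E.
  rewrite /entropy (_ : [set _ | _ in _] = [set 0%E]) ?ereal_sup1//.
  apply/seteqP; split => [_ [U /h -> <-]//|_ ->].
  by exists [set setT] => //; exact: h.
(* The same [V] bounds the cover numbers of all powers of [S] by [N], so the sequence lies between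
   [0] and a constant over [n]. *)
move=> /refine[V fV rV]; pose N : R := (#|` fset_set V|)%:R.
have cN n : (cover_number R alpha (set_pow S n) U <= N%:E)%E.
  by apply: ereal_inf_lbound; exists V => //; split => // g W _; exact: rV.
have c1 n := cover_number_ge1 (set_pow S n) U x0.
have N1 : 1 <= N by rewrite -lee_fin; exact: le_trans (c1 0) (cN 0).
have ln2 : 0 < ln (2 : R) by rewrite ln_gt0// ltr1n.
apply: (@cvg_limn_einf_sup _ _ 0%E _).2.
apply: (@squeeze_cvge _ _ _ _ (cst 0%E) _
    (fun n => (ln N * (ln 2)^-1 * n%:R^-1)%:E)).
- near=> n; move: (c1 n) (cN n).
  case: (cover_number R alpha (set_pow S n) U) => [r| |]//.
  rewrite !lee_fin /log2e => r1 rN.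
  have r0 : 0 < r by exact: lt_le_trans r1.
  rewrite lne_EFin// -!EFinM !lee_fin; apply/andP; split.
    by rewrite !mulr_ge0 ?invr_ge0 ?ln_ge0 ?ler1n.
  rewrite !ler_wpM2r ?invr_ge0 ?(ltW ln2)//.
  by rewrite ler_ln// posrE (lt_le_trans r0).
- exact: cvg_cst.
- rewrite -[0%E]/((0:R)%:E) -(mulr0 (ln N * (ln 2)^-1)).
  apply: cvg_EFin; first by apply: nearW.
  apply: cvgM; first exact: cvg_cst.
  have := @cvg_harmonic R; rewrite -(cvg_shiftS (fun n => (n%:R : R)^-1)); exact.
Unshelve. all: by end_near. Qed.

End tube.

(** * Compact groups *)

Section haar_action_compact.
Context (R : realType) (k : scalar_kind) (G : topologicalGroupType).
Variables (mu : {measure set (borel G) -> \bar R}) (hmu : left_haar mu).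
Local Notation K := (scalars R k).
Local Notation X := (weak_star_ball (L1 k mu)).

Lemma haar_action_continuous : hausdorff_space G ->
  continuous (fun p : G * X => haar_action k hmu p.1 p.2).
Proof.
move=> hG [g0 l0]; apply: cvg_weak_star => u.
apply/cvg_sabsP => e e0; have e2 : 0 < e / 2 by rewrite divr_gt0.
pose v := L1_ltransl hmu g0 u.
have hl : \forall l \near l0, sabs (val (l0 : dual_ball (L1 k mu)) v -
    val (l : dual_ball (L1 k mu)) v : K) < e / 2.
  exact: (iffLR (@cvg_sabsP R k _ (nbhs l0) (nbhs_filter l0) _ _)
    (@weak_star_eval_continuous R k (L1 k mu) v l0) _ e2).
exists ([set g | L1norm1 (L1_ltransl hmu g u - v) < e / 2],
  [set l : X | sabs (val (l0 : dual_ball (L1 k mu)) v -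
    val (l : dual_ball (L1 k mu)) v : K) < e / 2]).
  by split => //; exact: L1_ltransl_near.
move=> -[g l] /= [hg hlv].
(* The difference splits into [(l0 - l) v], small by weak-star closeness, and
   [l (v - L1_ltransl hmu g u)], small because [l] has norm at most 1. *)
rewrite -[_ - _](subrKA (val (l : dual_ball (L1 k mu)) v)).
apply: le_lt_trans (ler_sabsD _ _) _; rewrite [e]splitr ltrD//.
have /set_mem lball := valP (l : dual_ball (L1 k mu)).
have [[l_lin _] _] := lball.
have -> : val (l : dual_ball (L1 k mu)) v -
    val (l : dual_ball (L1 k mu)) (L1_ltransl hmu g u) =
    val (l : dual_ball (L1 k mu)) (v - L1_ltransl hmu g u).
  by rewrite -mulN1r addrC -l_lin scaleN1r addrC.
apply: le_lt_trans (dual_ball_le _ lball) _.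
by rewrite distrC normL1E sre_of_real.
Qed.

Lemma compact_vanishing_entropy : hausdorff_space G -> compact [set: G] ->
  vanishing_entropy R (haar_action k hmu).
Proof.
move=> hG cG; exists setT; split => //.
  split => //; apply/seteqP; split => // g _; exists 1%N => //.
  by exists (fun=> g) => //; rewrite big_ord1.
have l0 : X.
  have h : dual_ball (L1 k mu) (fun=> 0).
    apply: dual_ballI => [a u v|u]; first by rewrite mulr0 addr0.
    by rewrite /sabs normr0 sre0 normL1E sre_of_real L1norm1_ge0.
  exact: (exist (fun m => m \in dual_ball (L1 k mu)) (fun=> 0) (mem_set h)).
apply: (entropy_eq0 R l0) => U fU; apply: finite_uniform_refinement => //.
  exact: compact_weak_star_ball.
exact: haar_action_continuous.
Qed.

End haar_action_compact.

(** * Word length with respect to a generating set *)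

Section word_length.
Variable G : topologicalGroupType.
Implicit Types (S : set G) (g h : G) (s : seq G).

(** Words as sequences can be concatenated and cut, unlike functions on ordinals. *)
Lemma set_powP S n g : set_pow S n g <->
  exists s, [/\ size s = n, forall x, x \in s -> S x & (\prod_(x <- s) x)%g = g].
Proof.
split=> [[f Sf <-]|[s [<- sS <-]]].
  exists [seq f i | i <- index_enum 'I_n]; split.
  - by rewrite size_map [index_enum _]unlock -enumT size_enum_ord.
  - by move=> _ /mapP[i _ ->].
  - by rewrite big_map.
exists (fun i : 'I_(size s) => nth 1%g s i).
  by move=> i; apply: sS; rewrite mem_nth.
by rewrite (big_nth 1%g) big_mkord.
Qed.

Lemma set_powM S m n g h : set_pow S m g -> set_pow S n h ->
  set_pow S (m + n) (g * h)%g.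
Proof.
move=> /set_powP[s [<- sS <-]] /set_powP[t [<- tS <-]]; apply/set_powP.
exists (s ++ t); split; [exact: size_cat| |exact: big_cat].
by move=> x; rewrite mem_cat => /orP[/sS|/tS].
Qed.

Lemma set_pow1 S g : S g -> set_pow S 1 g.
Proof.
move=> Sg; apply/set_powP; exists [:: g]; split => //.
  by move=> x; rewrite inE => /eqP ->.
by rewrite big_seq1.
Qed.

Lemma set_pow_id S n : S 1%g -> set_pow S n 1%g.
Proof.
move=> S1; apply/set_powP; exists (nseq n 1%g); split.
- exact: size_nseq.
- by move=> x; rewrite mem_nseq => /andP[_ /eqP ->].
- by rewrite big1_seq// => x /andP[_]; rewrite mem_nseq => /andP[_ /eqP ->].
Qed.

Lemma le_set_pow S m n : S 1%g -> (m <= n)%N -> set_pow S m `<=` set_pow S n.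
Proof.
move=> S1 mn g Sg; rewrite -(subnKC mn) -[g]mulg1.
by apply: set_powM => //; exact: set_pow_id.
Qed.

Lemma set_powS S n g : set_pow S n.+1 g ->
  exists a b, [/\ set_pow S n a, S b & g = (a * b)%g].
Proof.
move=> /set_powP[s]; case/lastP: s => [[]//|s b [/eqP]].
rewrite size_rcons eqSS => /eqP sn sS <-; exists (\prod_(x <- s) x)%g, b; split.
- apply/set_powP; exists s; split => // x xs; apply: sS.
  by rewrite mem_rcons inE xs orbT.
- by apply: sS; rewrite mem_rcons inE eqxx.
- by rewrite -cats1 big_cat big_seq1.
Qed.

Lemma compact_set_pow S n : compact S -> compact (set_pow S n).
Proof.
move=> cS; elim: n => [|n IHn].
  rewrite (_ : set_pow S 0 = [set 1%g]); first exact: compact_set1.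
  apply/seteqP; split => [_ [f _ <-]|_ ->]; first by rewrite big_ord0.
  by apply/set_powP; exists [::]; split => //; rewrite big_nil.
rewrite (_ : set_pow S n.+1 = (fun p : G * G => (p.1 * p.2)%g) @` (set_pow S n `*` S)).
  apply: continuous_compact; last exact: compact_setX.
  exact/continuous_subspaceT/mulg_continuous.
apply/seteqP; split=> [g /set_powS[a [b [Sa Sb ->]]]|_ [[a b] /= [Sa Sb] <-]].
  by exists (a, b).
by rewrite -addn1; apply: set_powM => //; exact: set_pow1.
Qed.

(** If every element of the power [n.+1] were shorter, the powers would stabilize at [n], and [G]
    would equal a power of [S], which is compact. *)
Lemma exists_word_length S n : compact S -> generating S -> ~ compact [set: G] ->
  exists2 g, set_pow S n g & forall m, (m < n)%N -> ~ set_pow S m g.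
Proof.
move=> cS [S1 Sgen] ncG; case: n => [|n].
  by exists 1%g => //; exact: set_pow_id.
apply: contrapT => noG; apply: ncG.
have stable : set_pow S n.+1 `<=` set_pow S n.
  move=> g Sg; apply: contrapT => nSg; apply: noG; exists g => // m mn Smg.
  by apply: nSg; exact: le_set_pow Smg.
have stableD j : set_pow S (n + j) `<=` set_pow S n.
  elim: j => [|j IHj]; first by rewrite addn0.
  move=> g; rewrite addnS => /set_powS[a [b [Sa Sb ->]]]; apply: stable.
  by rewrite -addn1; apply: set_powM; [exact: IHj|exact: set_pow1].
rewrite (_ : [set: G] = set_pow S n); first exact: compact_set_pow.
apply/seteqP; split => // g _.
have [m _ Smg] : (\bigcup_(m in [set m | (0 < m)%N]) set_pow S m) g by rewrite Sgen.
by apply: (stableD m); apply: le_set_pow Smg => //; exact: leq_addl.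
Qed.

(* The elements are suffixes, of lengths multiples of [K.+1], of a word of
   length [N * K.+1] that represents no shorter element. *)
Lemma exists_separated S K N : compact S -> generating S -> ~ compact [set: G] ->
  exists2 h : nat -> G, (forall j, (j < N)%N -> set_pow S (N * K.+1) (h j)) &
    forall i j, (j < i < N)%N -> ~ set_pow S K (h i * (h j)^-1)%g.
Proof.
move=> cS gS ncG; have [S1 _] := gS.
have [g] := exists_word_length (N * K.+1) cS gS ncG.
set n := (N * K.+1)%N => /set_powP[s [sn sS <-]] gmin.
pose h j := (\prod_(x <- drop (n - j * K.+1) s) x)%g.
have Sh j : (j < N)%N -> set_pow S (j * K.+1) (h j).
  move=> jN; apply/set_powP; exists (drop (n - j * K.+1) s); split => //.
    by rewrite size_drop sn subKn// leq_mul2r ltnW ?orbT.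
  by move=> x /mem_drop/sS.
exists h => [j jN|i j /andP[ji iN] SK].
  by apply: le_set_pow (Sh _ jN) => //; rewrite leq_mul2r ltnW ?orbT.
have jN := ltn_trans ji iN.
(* If [h i * (h j)^-1] were a product of [K] letters, replacing the middle of the word would give
   length [n - i * K.+1 + K + j * K.+1]. This is below [n] since [j < i], against minimality. *)
have gE : (\prod_(x <- s) x)%g =
    ((\prod_(x <- take (n - i * K.+1) s) x) * ((h i * (h j)^-1) * h j))%g.
  by rewrite mulgVK -big_cat cat_take_drop.
have Stake : set_pow S (n - i * K.+1) (\prod_(x <- take (n - i * K.+1) s) x)%g.
  apply/set_powP; exists (take (n - i * K.+1) s); split => //.
    by rewrite size_takel// sn leq_subr.
  by move=> x /mem_take/sS.
apply: (gmin _ _ (eq_ind_r (set_pow S _) (set_powM Stake (set_powM SK (Sh _ jN))) gE)).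
have iKn : (i * K.+1 <= n)%N by rewrite leq_mul2r ltnW ?orbT.
rewrite -[ltnRHS](subnK iKn) ltn_add2l.
have := leq_mul ji (leqnn K.+1); rewrite mulSn; apply: leq_trans.
by rewrite -addSn.
Qed.

End word_length.

(** * A compact set of positive measure *)

Section positive_piece.
Variables (G : topologicalGroupType) (R : realType).
Variables (mu : {measure set (borel G) -> \bar R}) (hmu : left_haar mu).

Lemma exists_positive_symmetric (S : set G) : hausdorff_space G -> compact S ->
  generating S -> exists n (A : set G), [/\ compact A, (0 < mu A)%E &
    forall a b, A a -> A b -> set_pow S n (a * b^-1)%g].
Proof.
move=> hG cS [S1 Sgen].
(* Inverses are controlled explicitly because [S] need not be symmetric. The sets [A n] cover [G],
   so they cannot all be null. *)
pose A n : set G := set_pow S n `&` [set x | set_pow S n (x^-1)%g].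
have cA n : compact (A n).
  apply: compact_closedI; first exact: compact_set_pow.
  apply: (@closed_comp _ _ (fun x : G => (x^-1)%g) (set_pow S n)).
    by move=> x _; exact: invg_continuous.
  by apply: compact_closed => //; exact: compact_set_pow.
have [n An] : exists n, mu (A n) != 0%E.
  apply: contrapT => nA.
  have /negligibleP : mu.-negligible ([set: G] : set (borel G)).
    rewrite (_ : [set: G] = \bigcup_n A n).
      apply: negligible_bigcup => n; apply/negligibleP.
        exact: measurable_compact.
      by apply: contrapT => An; apply: nA; exists n; exact/eqP.
    apply/seteqP; split => // x _.
    have pow y : exists m, set_pow S m y.
      have [m _ Sm] : (\bigcup_(m in [set m | (0 < m)%N]) set_pow S m) y by rewrite Sgen.
      by exists m.
    have [[m Sm] [m' Sm']] := (pow x, pow (x^-1)%g).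
    exists (m + m')%N => //; split.
      by apply: le_set_pow Sm => //; exact: leq_addr.
    by apply: le_set_pow Sm' => //; exact: leq_addl.
  by move=> /(_ measurableT) mu0; have := haar_neq0 hmu; rewrite mu0 eqxx.
exists (n + n)%N, (A n); split => //; first by rewrite lt0e An measure_ge0.
by move=> a b [Sa _] [_ Sb]; exact: set_powM.
Qed.

End positive_piece.

(** * Functionals given by integration against a bounded function *)

Section integration_functional.
Context d (T : measurableType d) (R : realType) (k : scalar_kind).
Variable mu : {measure set T -> \bar R}.
Local Notation K := (scalars R k).
Variable w : T -> R.
Hypotheses (mw : measurable_fun setT w) (w1 : forall x, `|w x| <= 1).

Lemma integrable_mul_bounded (p : T -> R) : mu.-integrable setT (EFin \o p) ->
  mu.-integrable setT (EFin \o (fun x => w x * p x)).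
Proof.
move=> ip; apply: (le_integrable measurableT _ _ ip).
  apply/measurable_EFinP; apply: measurable_funM => //.
  by apply/measurable_EFinP; exact: measurable_int ip.
by move=> x _ /=; rewrite lee_fin normrM ler_piMl.
Qed.

(* With the factor [2^-1] the bound [|l u| <= |re (l u)| + |im (l u)|]
   suffices to see that the norm is at most 1. *)
Definition half_integral (p : T -> R) : R := 2^-1 * \int[mu]_x (w x * p x).

Lemma half_integralD p q : mu.-integrable setT (EFin \o p) ->
  mu.-integrable setT (EFin \o q) ->
  half_integral (fun x => p x + q x) = half_integral p + half_integral q.
Proof.
move=> ip iq; rewrite /half_integral -mulrDr -RintegralD//; first last.
- exact: integrable_mul_bounded.
- exact: integrable_mul_bounded.
by congr (_ * _); apply: eq_Rintegral => x _; rewrite mulrDr.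
Qed.

Lemma half_integralZ a p : mu.-integrable setT (EFin \o p) ->
  half_integral (fun x => a * p x) = a * half_integral p.
Proof.
move=> ip; rewrite /half_integral [RHS]mulrCA -[in RHS]RintegralZl//; last first.
  exact: integrable_mul_bounded.
by congr (_ * _); apply: eq_Rintegral => x _; rewrite mulrCA.
Qed.

Lemma half_integral_le p q : mu.-integrable setT (EFin \o p) ->
  mu.-integrable setT (EFin \o q) -> (forall x, `|p x| <= q x) ->
  `|half_integral p| <= 2^-1 * \int[mu]_x q x.
Proof.
move=> ip iq pq; rewrite /half_integral normrM ger0_norm// ler_wpM2l//.
have iwp := integrable_mul_bounded ip.
apply: le_trans (le_normr_Rintegral measurableT iwp) _.
apply: le_Rintegral => //; first exact: (integrable_norm iwp).
by move=> x _; apply: le_trans (pq x); rewrite normrM ler_piMl.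
Qed.

Lemma eq_half_integral p q : mu.-integrable setT (EFin \o p) ->
  mu.-integrable setT (EFin \o q) -> p = q %[ae mu] ->
  half_integral p = half_integral q.
Proof.
move=> ip iq pq; rewrite /half_integral; congr (_ * _); congr fine.
apply: ae_eq_integral => //.
- exact: measurable_int (integrable_mul_bounded ip).
- exact: measurable_int (integrable_mul_bounded iq).
- by apply: filterS pq => x px xT; rewrite px.
Qed.

(** As [w] is real, this is half the integral of [w * u], formed separately from real and imaginary
    parts; over the reals [scalar_of] drops the second. *)
Definition integration_functional (u : L1 k mu) : K :=
  scalar_of k (half_integral (@sre R k \o repr u)) (half_integral (@sim R k \o repr u)).

Lemma integration_functionalE (f : L1fun k mu) :
  integration_functional (L1class f) =
  scalar_of k (half_integral (@sre R k \o f)) (half_integral (@sim R k \o f)).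
Proof.
have [fr fi] := L1funP f; have [gr gi] := L1funP (repr (L1class f)).
have /L1classP fg : L1class (repr (L1class f)) = L1class f by exact: L1classK.
rewrite /integration_functional; congr (scalar_of _ _ _); apply: eq_half_integral => //.
- by apply: filterS fg => x fx xT /=; rewrite fx.
- by apply: filterS fg => x fx xT /=; rewrite fx.
Qed.

Lemma integration_functional_linear : scalar integration_functional.
Proof.
move=> a u v; rewrite -[u]L1classK -[v]L1classK -L1classZ -L1classD.
rewrite !integration_functionalE -scalar_ofM -scalar_ofD.
move: (repr u) (repr v) => f g.
have [fr fi] := L1funP f; have [gr gi] := L1funP g.
have iZ b p : mu.-integrable setT (EFin \o p) ->
    mu.-integrable setT (EFin \o (fun x => b * p x)).
  by move=> ip; apply: eq_integrable (integrableZl measurableT b ip).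
have iD p q : mu.-integrable setT (EFin \o p) -> mu.-integrable setT (EFin \o q) ->
    mu.-integrable setT (EFin \o (fun x => p x + q x)).
  by move=> ip iq; apply: eq_integrable (integrableD measurableT ip iq).
congr (scalar_of _ _ _).
- have [ir ii] := (iZ (sre a) _ fr, iZ (- sim a) _ fi); have irr := iD _ _ ir ii.
  rewrite -mulNr -!half_integralZ// -!half_integralD//.
  congr half_integral; apply/funext => x /=.
  by rewrite -[(a *: _ + _) x]/(a * f x + g x) sreD sreM mulNr.
- have [ir ii] := (iZ (sre a) _ fi, iZ (sim a) _ fr); have irr := iD _ _ ir ii.
  rewrite -!half_integralZ// -!half_integralD//.
  congr half_integral; apply/funext => x /=.
  by rewrite -[(a *: _ + _) x]/(a * f x + g x) simD simM.
Qed.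

Lemma integration_functional_ball : dual_ball (L1 k mu) integration_functional.
Proof.
apply: dual_ballI => [|u]; first exact: integration_functional_linear.
rewrite -[u]L1classK integration_functionalE normL1E sre_of_real L1norm1E.
apply: le_trans (sabs_scalar_of _ _ _) _.
move: (repr u) => f; have [fr fi] := L1funP f; have fa := integrable_sabs f.
rewrite -[leRHS]mul1r (splitr 1) mulrDl mul1r.
apply: lerD; apply: half_integral_le => // x.
  exact: normr_sre_le.
exact: normr_sim_le.
Qed.

End integration_functional.

(** * Lower bounds for cover numbers and entropy *)

Section entropy_lower_bound.
Variables (R : realType) (G : topologicalGroupType) (X : topologicalType).
Variable alpha : G -> X -> X.

Lemma limn_esup_ge (u : nat -> \bar R) (c : \bar R) :
  (forall m, exists2 n, (m <= n)%N & (c <= u n)%E) -> (c <= limn_esup u)%E.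
Proof.
move=> uc; apply: le_ereal_inf_tmp => _ [V [m _ mV] <-].
have [n mn cn] := uc m; apply: le_trans cn _; apply: ereal_sup_ubound.
by exists n => //; exact: mV.
Qed.

(** If [b] and [b'] differ at [j], no member of a refining cover contains both [x b] and [x b']: its
    image under [h j] would lie in [U1] or in [U2], and each set excludes one of the two images.
    Choosing a member around each [x b] is thus injective. *)
Lemma cover_number_ge_expn2 (S : set G) (U1 U2 : set X) N (h : 'I_N -> G)
    (x : {ffun 'I_N -> bool} -> X) :
  (forall j, S (h j)) ->
  (forall (b : {ffun 'I_N -> bool}) j, b j -> ~ U1 (alpha (h j) (x b))) ->
  (forall (b : {ffun 'I_N -> bool}) j, ~~ b j -> ~ U2 (alpha (h j) (x b))) ->
  ((2 ^ N)%:R%:E <= cover_number R alpha S [set U1; U2])%E.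
Proof.
move=> Sh xU1 xU2; apply: le_ereal_inf_tmp => _ [V [[fV _ Vcov] rV] <-].
have /choice[phi phiP] (b : {ffun 'I_N -> bool}) : exists W, V W /\ W (x b).
  have [W VW Wx] : (\bigcup_(W in V) W) (x b) by rewrite Vcov.
  by exists W.
have phi_inj : injective phi.
  suff sep b b' j : phi b = phi b' -> b j -> b' j.
    by move=> b b' bb'; apply/ffunP => j; apply/idP/idP; exact: sep.
  move=> bb' bj; apply: contrapT => /negP b'j.
  have [A UA WA] := rV _ _ (Sh j) (phiP b).1.
  have Ab : A (alpha (h j) (x b)) by apply: WA; exists (x b) => //; exact: (phiP b).2.
  have Ab' : A (alpha (h j) (x b')).
    by apply: WA; exists (x b') => //; rewrite bb'; exact: (phiP b').2.
  by case: UA => AE; rewrite AE in Ab Ab'; [exact: xU1 bj Ab|exact: xU2 b'j Ab'].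
rewrite lee_fin ler_nat.
have <- : size [seq phi b | b <- enum {ffun 'I_N -> bool}] = (2 ^ N)%N.
  by rewrite size_map -cardE card_ffun card_bool card_ord.
apply: uniq_leq_size; first by rewrite map_inj_uniq ?enum_uniq.
by move=> _ /mapP[b _ ->]; rewrite in_fset_set// inE; exact: (phiP b).1.
Qed.

Lemma cover_entropy_ge S U M : (0 < M)%N ->
  (forall N, ((2 ^ N)%:R%:E <= cover_number R alpha (set_pow S (N * M)) U)%E) ->
  ((M%:R^-1)%:E <= cover_entropy R alpha S U)%E.
Proof.
(* Multiples of [M] suffice for a lower bound on the limsup; [m.+1] keeps the index nonzero. *)
move=> M0 cN; apply: limn_esup_ge => m; exists (m.+1 * M)%N.
  by apply: leq_trans (leqnSn m) _; rewrite leq_pmulr.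
have ln2 : 0 < ln (2 : R) by rewrite ln_gt0// ltr1n.
have log2X : log2e (((2 ^ m.+1)%:R : R)%:E) = (m.+1%:R : R)%:E.
  rewrite /log2e lne_EFin ?ltr0n ?expn_gt0// natrX lnXn ?ltr0n//.
  by rewrite -EFinM -(mulr_natl (ln 2)) mulfK// gt_eqF.
apply: (@le_trans _ _ (log2e (((2 ^ m.+1)%:R : R)%:E) * ((m.+1 * M)%:R^-1)%:E)%E).
  rewrite log2X -EFinM lee_fin natrM invfM mulrA divff ?mul1r//.
apply: lee_wpmul2r; first by rewrite lee_fin invr_ge0.
apply: lee_wpmul2r; first by rewrite lee_fin invr_ge0 ltW.
rewrite lee_lne ?cN// in_itv/= ?leey ?andbT ?lee_fin//.
by apply: le_trans (cN _); rewrite lee_fin.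
Qed.

End entropy_lower_bound.

(** * Noncompact groups *)

Section haar_action_noncompact.
Context (R : realType) (k : scalar_kind) (G : topologicalGroupType).
Variables (mu : {measure set (borel G) -> \bar R}) (hmu : left_haar mu).
Hypothesis hG : hausdorff_space G.
Local Notation K := (scalars R k).
Local Notation X := (weak_star_ball (L1 k mu)).

Variables (A : set G).
Hypotheses (cA : compact A) (A_gt0 : (0 < mu A)%E).

Let mA : measurable (A : set (borel G)). Proof. exact: measurable_compact. Qed.

Let A_fin : (mu A < +oo)%E. Proof. exact: haar_compact hmu _ cA. Qed.

Let fA_gt0 : 0 < fine (mu A). Proof. by rewrite fine_gt0// A_gt0. Qed.

Definition normalized_indic (x : borel G) : R := (fine (mu A))^-1 * \1_A x.

Lemma normalized_indic_integrable : mu.-integrable setT (EFin \o normalized_indic).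
Proof.
by apply: eq_integrable (integrableZl measurableT (fine (mu A))^-1
  (integrable_indic mA A_fin)).
Qed.

Lemma L1fun_normalized_indic_subproof :
  (of_real k \o normalized_indic : borel G -> K) \in L1fun_pred mu.
Proof.
rewrite inE; split.
- rewrite (_ : _ \o _ = EFin \o normalized_indic); last first.
    by apply/funext => x /=; rewrite sre_of_real.
  exact: normalized_indic_integrable.
- rewrite (_ : _ \o _ = cst 0%E); first exact: integrable0.
  by apply/funext => x /=; rewrite sim_of_real.
Qed.

Definition L1fun_normalized_indic : L1fun k mu :=
  mkL1fun L1fun_normalized_indic_subproof.

Definition sign_fun (E : set G) : borel G -> R := fun x => 2 * \1_E x - 1.

Lemma sign_fun_in E x : E x -> sign_fun E x = 1.
Proof. by move=> Ex; rewrite /sign_fun indicE mem_set//=; lra. Qed.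

Lemma sign_fun_notin E x : ~ E x -> sign_fun E x = - 1.
Proof. by move=> Ex; rewrite /sign_fun indicE memNset//=; lra. Qed.

Lemma sign_fun_le1 E x : `|sign_fun E x| <= 1.
Proof.
by have [/sign_fun_in ->|/sign_fun_notin ->] := pselect (E x); rewrite ?normrN normr1.
Qed.

Lemma measurable_sign_fun E : measurable (E : set (borel G)) ->
  measurable_fun setT (sign_fun E).
Proof.
by move=> mE; apply: measurable_funB => //; exact: measurable_funM.
Qed.

Definition sign_functional E (mE : measurable (E : set (borel G))) : X :=
  exist (fun m => m \in dual_ball (L1 k mu))
    (integration_functional (k := k) (mu := mu) (sign_fun E))
    (mem_set (integration_functional_ball k mu (measurable_sign_fun mE)
      (sign_fun_le1 E))).

Definition normalized_value (l : X) : R :=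
  sre (val (l : dual_ball (L1 k mu)) (L1class L1fun_normalized_indic) : K).

Lemma normalized_value_continuous : continuous normalized_value.
Proof.
move=> l; apply: (@continuous_comp _ _ _ (fun m : X => val (m : dual_ball (L1 k mu))
   (L1class L1fun_normalized_indic) : K) (@sre R k)).
  exact: weak_star_eval_continuous.
exact: continuous_sre.
Qed.

(** The translated indicator lives where [A (g * x)%g] holds, and there the sign is [c]. Left
    invariance makes its integral 1, and [2^-1] comes from [half_integral]. *)
Lemma normalized_value_sign_functional E (mE : measurable (E : set (borel G)))
    (g : G) (c : R) : (forall x, A (g * x)%g -> sign_fun E x = c) ->
  normalized_value (haar_action k hmu g (sign_functional mE)) = 2^-1 * c.
Proof.
move=> wc; rewrite /normalized_value haar_actionE /= integration_functionalE; last 2 first.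
- exact: measurable_sign_fun.
- exact: sign_fun_le1.
rewrite sre_scalar_of /half_integral; congr (_ * _).
transitivity (\int[mu]_x (c * normalized_indic (ltransl g x))).
  apply: eq_Rintegral => x _; rewrite /= sre_of_real /normalized_indic indicE.
  have [/set_mem Ax|_] := boolP (_ \in A); last by rewrite !mulr0.
  by rewrite wc.
rewrite RintegralZl//; last exact: (integrable_ltransl hmu g normalized_indic_integrable).
rewrite -[RHS]mulr1; congr (_ * _).
have -> : \int[mu]_x normalized_indic (ltransl g x) = \int[mu]_x normalized_indic x.
  congr fine; apply: (integral_ltransl hmu g (f := EFin \o normalized_indic)).
    exact: measurable_int normalized_indic_integrable.
  by move=> x; rewrite lee_fin mulr_ge0// invr_ge0 ltW.
rewrite RintegralZl//; last exact: integrable_indic.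
by rewrite /Rintegral integral_indic// setIT mulVf// gt_eqF.
Qed.

(** The two sets overlap and cover the ball, yet the values [2^-1] and [- 2^-1] each lie in only one
    of them. *)
Definition sign_cover : set (set X) :=
  [set [set l | normalized_value l < 4^-1]; [set l | - 4^-1 < normalized_value l]].

Lemma finite_open_cover_sign_cover : finite_open_cover sign_cover.
Proof.
split; first exact: finite_set2.
- move=> _ [->|->].
    apply: (@open_comp _ _ normalized_value [set r | r < 4^-1]); last exact: open_lt.
    by move=> x _; exact: normalized_value_continuous.
  apply: (@open_comp _ _ normalized_value [set r | - 4^-1 < r]); last exact: open_gt.
  by move=> x _; exact: normalized_value_continuous.
apply/seteqP; split => // l _.
have [lt|ge] := ltP (normalized_value l) 4^-1.
  by exists [set l | normalized_value l < 4^-1] => //; left.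
exists [set l | - 4^-1 < normalized_value l]; first by right.
by rewrite /=; lra.
Qed.

Lemma sign_cover_number_ge (S : set G) N (h : 'I_N -> G) : (forall j, S (h j)) ->
  (forall i j, i != j -> forall x, A (h i * x)%g -> ~ A (h j * x)%g) ->
  ((2 ^ N)%:R%:E <= cover_number R (haar_action k hmu) S sign_cover)%E.
Proof.
move=> Sh Adisj.
(* By disjointness, [sign_fun (E b)] is 1 on the [j]-th translate of [A] when [b j] holds and -1
   there otherwise. *)
pose E (b : {ffun 'I_N -> bool}) : set G :=
  \bigcup_(j in [set j | b j]) [set x | A (h j * x)%g].
have mE b : measurable (E b : set (borel G)).
  apply: fin_bigcup_measurable => [|j _]; first exact: finite_finset.
  by rewrite -[X in measurable X]setTI; exact: measurable_ltransl.
apply: (@cover_number_ge_expn2 _ _ _ _ _ _ _ _ h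
  (fun b => sign_functional (mE b))) => //= b j bj.
  rewrite (@normalized_value_sign_functional _ _ _ 1); first by apply/negP; lra.
  by move=> x Ax; apply: sign_fun_in; exists j.
rewrite (@normalized_value_sign_functional _ _ _ (-1)); first by apply/negP; lra.
move=> x Ax; apply: sign_fun_notin => -[i /= bi]; apply: Adisj Ax.
by apply: contraNneq bj => ->.
Qed.

End haar_action_noncompact.

(** * Positive entropy of noncompact groups and the equivalence *)

Lemma entropy_gt0 (R : realType) (k : scalar_kind) (G : topologicalGroupType)
    (mu : {measure set (borel G) -> \bar R}) (hmu : left_haar mu) (S : set G) :
  hausdorff_space G -> compact S -> generating S -> ~ compact [set: G] ->
  (0 < entropy R (haar_action k hmu) S)%E.
Proof.
move=> hG cS gS ncG.
have [n [A [cA A_gt0 AS]]] := exists_positive_symmetric hmu hG cS gS.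
(* Separation is used with [K = n], so suffix lengths are multiples of [n.+1]. *)
apply: (@lt_le_trans _ _ ((n.+1%:R^-1)%:E)); first by rewrite lte_fin invr_gt0.
apply: (@le_trans _ _ (cover_entropy R (haar_action k hmu) S (sign_cover (k := k) hmu hG cA))).
  apply: cover_entropy_ge => // N.
  have [h Sh hsep] := exists_separated n N cS gS ncG.
  apply: (sign_cover_number_ge k hmu hG cA A_gt0 (h := fun j : 'I_N => h j))
    => [j|i j]; first exact: Sh.
  move=> ij x Ai Aj.
  wlog ji : i j ij Ai Aj / (j < i)%N.
    move=> H; have /orP[] : (j < i)%N || (i < j)%N by rewrite orbC -neq_ltn.
      exact: H.
    by apply: H => //; rewrite eq_sym.
  (* A common point [x] would put [(h i * x) * (h j * x)^-1 = h i * (h j)^-1] in the [n]-th power of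
     [S]. *)
  apply: (hsep i j); first by rewrite ji ltn_ord.
  by have := AS _ _ Ai Aj; rewrite invgM mulgA mulgK.
apply: ereal_sup_ubound; exists (sign_cover (k := k) hmu hG cA) => //.
exact: finite_open_cover_sign_cover.
Qed.


Theorem corollary5p7 (R : realType) (k : scalar_kind) (G : topologicalGroupType)
    (G_compactly_generated : compactly_generated G)
    (G_locally_compact : locally_compact [set: G])
    (G_hausdorff : hausdorff_space G)
    (mu : {measure set (borel G) -> \bar R}) (mu_haar : left_haar mu) :
  compact [set: G] <-> vanishing_entropy R (haar_action k mu_haar).
Proof.
split; first exact: compact_vanishing_entropy.
move=> [S [cS gS entropy0]]; apply: contrapT => ncG.
by have := entropy_gt0 k mu_haar G_hausdorff cS gS ncG; rewrite entropy0 ltxx.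
Qed.
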